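(* Let $(X,\tau)$ be a Polish topological space, let $\mathfrak m\in\mathcal M_+(X)$ be a finite Borel measure on $X$, and let $p\in(1,\infty)$. Then: (1) the set function $\mathrm{Mod}_{p,\mathfrak m}$ is a Choquet capacity in $\mathcal M_+(X)$; (2) every Souslin set $\Sigma\subset\mathcal M_+(X)$ is $\mathrm{Mod}_{p,\mathfrak m}$-capacitable and satisfies $$\mathrm{Mod}_{p,\mathfrak m}(\Sigma)^{1/p}=C_{p,\mathfrak m}(\Sigma);$$ (3) if moreover $\Sigma\subset\mathcal M_+(X)$ is compact, then $\mathrm{Mod}_{p,\mathfrak m}(\Sigma)=\mathrm{Mod}_{p,\mathfrak m,c}(\Sigma)$.
   Context: $\mathcal M_+(X)$ is the set of finite nonnegative Borel measures on $X$, endowed with the Polish topology of weak convergence in duality with the space $C_b(X)$ of bounded continuous functions. Let $q=p/(p-1)$. $\mathcal L^p_+(X,\mathfrak m)$ is the set of Borel functions $f:X\to[0,\infty]$ with $\int_X f^p\,d\mathfrak m<\infty$ (functions, not equivalence classes), and $\|f\|_p=(\int_X|f|^p\,d\mathfrak m)^{1/p}$. For $\Sigma\subset\mathcal M_+(X)$ (with $\inf\emptyset=\infty$): $$\mathrm{Mod}_{p,\mathfrak m}(\Sigma)=\inf\Big\{\int_X f^p\,d\mathfrak m:\ f\in\mathcal L^p_+(X,\mathfrak m),\ \int_X f\,d\mu\ge1\ \text{for all }\mu\in\Sigma\Big\},$$ $$\mathrm{Mod}_{p,\mathfrak m,c}(\Sigma)=\inf\Big\{\int_X f^p\,d\mathfrak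 m:\ f\in C_b(X),\ f\ge 0,\ \int_X f\,d\mu\ge1\ \text{for all }\mu\in\Sigma\Big\}.$$ A plan with barycenter in $L^q(X,\mathfrak m)$ is a Borel probability measure $\boldsymbol\eta$ on $\mathcal M_+(X)$ for which there is $c\in[0,\infty)$ with $\int\int_X f\,d\mu\,d\boldsymbol\eta(\mu)\le c\|f\|_p$ for all $f\in\mathcal L^p_+(X,\mathfrak m)$; $c_q(\boldsymbol\eta)$ denotes the minimal such $c$. For a universally measurable $\Sigma\subset\mathcal M_+(X)$, $$C_{p,\mathfrak m}(\Sigma)=\sup_{c_q(\boldsymbol\eta)>0}\frac{\boldsymbol\eta(\Sigma)}{c_q(\boldsymbol\eta)},$$ the supremum being over plans $\boldsymbol\eta$ with barycenter in $L^q(X,\mathfrak m)$ (the supremum of the empty set of nonnegative numbers is $0$); by convention $C_{p,\mathfrak m}(\Sigma)=\infty$ if $\Sigma$ contains the null measure. A subset of a Hausdorff topological space is Souslin if it is the image of a Polish space under a continuous map (Souslin subsets of Polish spaces are universally measurable). A (Choquet) capacity in a topological space $E$ is a function $\mathfrak I$ from all subsets of $E$ to $[0,\infty]$ that is nondecreasing, satisfies $\lim_n\mathfrak I(A_n)=\mathfrak I(\bigcup_n A_n)$ for every nondecreasing sequence $(A_n)$ of subsets, and $\lim_n\mathfrak I(K_n)=\mathfrak I(\bigcap_n K_n)$ for every nonincreasing sequence $(K_n)$ of compact sets. A set $B\subset E$ is $\mathfrak I$-capacitable if $\mathfrak I(B)=\sup\{\mathfrak I(K): K\subset B,\ K\text{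 compact}\}$. *)

(* Defs.v *)
From HB Require Import structures.
From mathcomp Require Import all_boot all_order all_algebra.
From mathcomp Require Import all_classical all_reals all_analysis.
From mathcomp Require Import measurable_realfun.

Set Implicit Arguments.
Unset Strict Implicit.
Unset Printing Implicit Defensive.

Import Order.TTheory GRing.Theory Num.Theory.
Import numFieldNormedType.Exports.

Local Open Scope classical_set_scope.
Local Open Scope ring_scope.

(* Completeness is phrased with an explicit limit point because the library's
   [cvg] is only available on pointed types, whereas the empty space has to be
   Polish here (the empty set is Souslin). *)
Definition polish (R : realType) (X : topologicalType) : Prop :=
  (exists2 D : set X, countable D & dense D) /\
  exists (M : metricType R) (f : X -> M) (g : M -> X),
    [/\ cancel f g, cancel g f, continuous f, continuous g &
      forall F : set_system M, ProperFilter F -> cauchy F ->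
        exists l : M, F --> l].

Definition souslin (R : realType) (E : topologicalType) (A : set E) : Prop :=
  exists (Y : topologicalType) (g : Y -> E),
    [/\ polish R Y, continuous g & range g = A].

Notation borel X := (g_sigma_algebraType (@open X)).

(* A library measure is a function on all subsets, whose values on non-measurable
   sets are unconstrained, so that one and the same measure is represented by
   many different functions.  [Mplus] keeps the representative vanishing outside
   of the sigma-algebra: two elements of [Mplus] are equal iff they agree on
   Borel sets.  Without this the weak topology would not be Hausdorff. *)
Record Mplus (R : realType) (X : ptopologicalType) := MkMplus {
  Mplus_measure :> {finite_measure set (borel X) -> \bar R} ;
  Mplus_canonical : forall A : set (borel X),
    ~ measurable A -> Mplus_measure A = 0%E }.

Definition Mplus0 (R : realType) (X : ptopologicalType) : Mplus R X :=
  @MkMplus R X (@mzero _ (borel X) R) (fun _ _ => erefl).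

Definition Cb (R : realType) (X : topologicalType) : set (X -> R) :=
  [set f | continuous f /\ bounded_fun f].

Definition Mplus_int (R : realType) (X : ptopologicalType) (f : X -> R)
  (mu : Mplus R X) : R := \int[mu]_x f x.

HB.instance Definition _ (R : realType) (X : ptopologicalType) :=
  gen_eqMixin (Mplus R X).
HB.instance Definition _ (R : realType) (X : ptopologicalType) :=
  gen_choiceMixin (Mplus R X).
HB.instance Definition _ (R : realType) (X : ptopologicalType) :=
  isPointed.Build (Mplus R X) (Mplus0 R X).
(* The coarsest topology making mu |-> \int f dmu continuous for all f in Cb. *)
HB.instance Definition _ (R : realType) (X : ptopologicalType) :=
  Topological.copy (Mplus R X)
    (sup_topology (fun f : {f : X -> R | Cb f} =>
       Topological.class (initial_topology (@Mplus_int R X (sval f))))).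

Section modulus_and_content.
Local Open Scope ereal_scope.
Variables (R : realType) (X : ptopologicalType) (m : Mplus R X) (p : R).

Definition Lplus : set (borel X -> \bar R) :=
  [set f : borel X -> \bar R | [/\ measurable_fun [set: borel X] f, forall x, 0 <= f x &
               \int[m]_x (f x `^ p) < +oo]].

Definition Modp (Sigma : set (Mplus R X)) : \bar R :=
  ereal_inf [set \int[m]_x (f x `^ p) | f in
    [set f : borel X -> \bar R | Lplus f /\ forall mu, Sigma mu -> 1 <= \int[mu]_x f x]].

Definition Modpc (Sigma : set (Mplus R X)) : \bar R :=
  ereal_inf [set \int[m]_x ((f x)%:E `^ p) | f in
    [set f : X -> R | [/\ Cb f, forall x, (0 <= f x)%R &
      forall mu, Sigma mu -> 1 <= \int[mu]_x (f x)%:E]]].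

(* The exponent q = p/(p-1) of the barycenter enters only through this duality
   with L^p. *)
Definition barycenter_bound (eta : probability (borel (Mplus R X)) R) (c : R) :
    Prop :=
  (0 <= c)%R /\
  forall f, Lplus f ->
    \int[eta]_(mu in [set: Mplus R X]) \int[mu]_x f x <= c%:E * 'N[m]_p%:E[f].

Definition has_barycenter (eta : probability (borel (Mplus R X)) R) : Prop :=
  exists c : R, barycenter_bound eta c.

Definition cq (eta : probability (borel (Mplus R X)) R) : R :=
  inf [set c | barycenter_bound eta c].

(* [mu_ext eta] is the outer measure of eta; on universally measurable sets,
   which need not be Borel, it is the value of the completion of eta.  The 0
   makes the supremum over no plan equal to 0. *)
Definition Cp (Sigma : set (Mplus R X)) : \bar R :=
  if `[< Sigma (Mplus0 R X) >] then +oo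
  else ereal_sup (0 |` [set mu_ext eta Sigma * (cq eta)^-1%:E | eta in
    [set eta | has_barycenter eta /\ (0 < cq eta)%R]]).

End modulus_and_content.

Definition choquet_capacity (R : realType) (E : topologicalType)
    (I : set E -> \bar R) : Prop :=
  [/\ forall A, (0 <= I A)%E,
      forall A B, A `<=` B -> (I A <= I B)%E,
      forall A : nat -> set E, (forall n, A n `<=` A n.+1) ->
        I (A n) @[n --> \oo] --> I (\bigcup_n A n) &
      forall K : nat -> set E, (forall n, compact (K n)) ->
        (forall n, K n.+1 `<=` K n) ->
        I (K n) @[n --> \oo] --> I (\bigcap_n K n)].

Definition capacitable (R : realType) (E : topologicalType)
    (I : set E -> \bar R) (B : set E) : Prop :=
  I B = ereal_sup [set I K | K in [set K | compact K /\ K `<=` B]].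

(* Main.v *)
(* The modulus is continuous along increasing sequences by uniform convexity of
   [L^p]: nearly optimal functions for [A_n] have admissible midpoints, hence are
   Cauchy, and the supremum of a fast subsequence is admissible for the union.

   For a compact [K] not containing the null measure, the Hahn-Banach theorem
   gives a positive normalized functional [L] on continuous functions on [K] with
   [L (mu |-> \int f dmu) <= (Modpc K)^(-1/p) ||f||_p] for all [f >= 0] in [Cb];
   a measure representing [L] is a plan carried by [K], and the bound extends
   from [Cb] to Borel functions by regularity of its barycenter.  Together with
   Markov's inequality this gives
   [(Modpc K)^(1/p) <= Cp K <= (Modp K)^(1/p) <= (Modpc K)^(1/p)].

   Since the modulus of a compact set is computed by continuous functions, it is
   the infimum of the moduli of open neighborhoods; hence continuity along
   decreasing compact sets, and Choquet's capacitability of Souslin sets extends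
   the equality of modulus and content from compact to Souslin sets. *)

Require Import Defs.
From HB Require Import structures.
From mathcomp Require Import all_boot all_order all_algebra.
From mathcomp Require Import all_classical all_reals all_analysis.
From mathcomp Require Import measurable_realfun ring lra.

Set Implicit Arguments.
Unset Strict Implicit.
Unset Printing Implicit Defensive.

Import Order.TTheory GRing.Theory Num.Theory.
Import numFieldNormedType.Exports.

Local Open Scope classical_set_scope.
Local Open Scope ring_scope.

(** The content asks for one plan that serves all [f], whereas the modulus only gives, for each [f],
    a measure depending on [f]. The exchange is a minimax statement, obtained from a single gauge on
    continuous functions of the measure: the infimum of [t + l ||f||_p] over all [t + \int f dmu]
    with [f >= 0] that dominate the given function on the compact set. It encodes positivity,
    normalization and the norm bound at once, and having a measure for each [f] is what keeps it
    above [-oo].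

    The weak topology enters through complete regularity and the Hausdorff property, both read off
    from the functionals [mu |-> \int f dmu]. The representing measure comes from an upper integral
    of indicators, and only [\int phi <= L phi] is established, the direction in which plans are
    bounded.

    Admissible functions may take the value [+oo], so uniform convexity is used in a form without
    differences: [\int max (f ^ p, g ^ p)] exceeds [\int f ^ p] by at most a small term plus a
    multiple of the midpoint defect. Such maxima also produce a majorant defined everywhere, as
    admissibility demands. *)

(** * Scalar uniform convexity of [x ^ p] *)

Section power_convexity.
Variables (R : realType) (p : R).
Hypothesis p1 : 1 < p.

Let p0 : 0 < p. Proof. exact: lt_trans p1. Qed.

(* Both inequalities come from [1 + s <= exp s], used at [s = (p - 1) ln y] and
   at [s = - ln y], where it is strict. *)
Lemma powR_gt_tangent1 (y : R) : 0 <= y -> y != 1 -> 1 + p * (y - 1) < y `^ p.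
Proof.
rewrite le_eqVlt => /predU1P[<- _|y0 y1].
  by rewrite powR0 ?gt_eqF//; have := p1; lra.
have ln0 : - ln y != 0 by rewrite oppr_eq0 ln_eq0.
have E1 := expR_gt1Dx ln0.
have E2 := expR_ge1Dx ((p - 1) * ln y).
have y1E : expR (- ln y) = y^-1 by rewrite expRN lnK.
have ypE : y * expR ((p - 1) * ln y) = y `^ p.
  rewrite /powR gt_eqF// -[X in X * _](lnK y0) -expRD; congr expR; ring.
have E3 : p < expR ((p - 1) * ln y) + (p - 1) * y^-1.
  rewrite y1E in E1; have := p1; nra.
have := ltr_pM2l y0; move=> /(_ p (expR ((p - 1) * ln y) + (p - 1) / y)).
rewrite E3 mulrDr ypE mulrCA divff ?gt_eqF// mulr1; lra.
Qed.

Lemma powR_ge_tangent1 (y : R) : 0 <= y -> 1 + p * (y - 1) <= y `^ p.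
Proof.
move=> y0; have [->|/eqP y1] := eqVneq y 1; first by rewrite powR1; lra.
by apply/ltW/powR_gt_tangent1 => //; apply/eqP.
Qed.

(** Writing [y = y0 * z] reduces this to the tangent inequality at [z], multiplied by
    [y0 ^ p >= y0]. It turns a gap at one point into a uniform one. *)
Lemma powR_tangent1_mono (y0 y : R) : 1 <= y0 -> y0 <= y ->
  y0 `^ p - 1 - p * (y0 - 1) <= y `^ p - 1 - p * (y - 1).
Proof.
move=> y01 yy.
have y0gt : 0 < y0 by lra.
pose z := y / y0.
have z1 : 0 <= z - 1 by rewrite subr_ge0 ler_pdivlMr// mul1r.
have -> : y = y0 * z by rewrite mulrCA divff ?mulr1 ?gt_eqF.
have H : 1 + p * (z - 1) <= z `^ p by apply: powR_ge_tangent1; lra.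
have H0 : y0 <= y0 `^ p by rewrite le1r_powR// ltW.
rewrite powRM; [|lra|lra].
set A := y0 `^ p in H0 *; set B := z `^ p in H *.
have : A * (1 + p * (z - 1)) <= A * B by apply: ler_wpM2l => //; lra.
have : 0 <= (A - y0) * (p * (z - 1)).
  by apply: mulr_ge0; [lra|apply: mulr_ge0 => //; exact: ltW].
nra.
Qed.

(** Dividing by the midpoint [c] turns [1] and [t] into two points symmetric about [1]. The tangent
    inequality is spent at [t / c] only; the linear terms cancel and the gap at [c^-1] survives. *)
Lemma powR_midpoint_gap (t : R) : 0 <= t ->
  ((1 + t) / 2) `^ p * (((2 / (1 + t)) `^ p - 1 - p * (2 / (1 + t) - 1)) / 2)
    <= (1 + t `^ p) / 2 - ((1 + t) / 2) `^ p.
Proof.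
move=> t0; have -> : 2 / (1 + t) = ((1 + t) / 2)^-1 by rewrite invf_div.
move cE : ((1 + t) / 2) => c.
have c0 : 0 < c by rewrite -cE; lra.
have E1 : c `^ p * c^-1 `^ p = 1.
  by rewrite -powRM ?invr_ge0 ?ltW// divff ?gt_eqF// powR1.
have E2 : c `^ p * (t / c) `^ p = t `^ p.
  rewrite -powRM ?divr_ge0 ?(ltW c0)//.
  by congr (_ `^ _); rewrite mulrCA divff ?mulr1// gt_eqF.
have H : 1 + p * (t / c - 1) <= (t / c) `^ p.
  by apply: powR_ge_tangent1; rewrite divr_ge0// ltW.
have E : c^-1 + t / c = 2.
  rewrite -[X in X + _]mul1r -mulrDl -cE invf_div mulrCA divff ?mulr1//.
  by rewrite gt_eqF//; lra.
have {}E : t / c = 2 - c^-1 by lra.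
have cp : 0 <= c `^ p by exact: powR_ge0.
rewrite E in H; rewrite E in E2.
have := ler_wpM2l cp H; rewrite E2.
nra.
Qed.

Lemma powR_midpoint_le (a b : R) : 0 <= a -> 0 <= b ->
  ((a + b) / 2) `^ p <= (a `^ p + b `^ p) / 2.
Proof.
move=> a0 b0; have [->|s0] := eqVneq (a + b) 0.
  by rewrite mul0r powR0 ?gt_eqF// divr_ge0 ?addr_ge0 ?powR_ge0.
move cE : ((a + b) / 2) => c.
have c0 : 0 < c by rewrite -cE divr_gt0// lt_def s0 addr_ge0.
have E (x : R) : 0 <= x -> c `^ p * (x / c) `^ p = x `^ p.
  move=> x0; rewrite -powRM ?divr_ge0 ?(ltW c0)//.
  by congr (_ `^ _); rewrite mulrCA divff ?mulr1// gt_eqF.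
have cp : 0 <= c `^ p by exact: powR_ge0.
have Ha := ler_wpM2l cp (powR_ge_tangent1 (divr_ge0 a0 (ltW c0))).
have Hb := ler_wpM2l cp (powR_ge_tangent1 (divr_ge0 b0 (ltW c0))).
rewrite !E// in Ha Hb.
have S : b / c = 2 - a / c.
  have : a / c + b / c = 2 by rewrite -mulrDl -cE invf_div mulrCA divff ?mulr1.
  lra.
rewrite S in Hb; nra.
Qed.

(* The midpoint defect of [x ^ p] on [1] and [t = a / b] is bounded below by a
   positive constant as long as [t ^ p <= 1 - e]; [C] is its inverse. *)
Lemma powR_maxr_le (e : R) : 0 < e -> exists2 C : R, 0 <= C &
  forall a b : R, 0 <= a -> 0 <= b ->
  Num.max (a `^ p) (b `^ p) + C * ((a + b) / 2) `^ p <=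
  a `^ p + e * (a `^ p + b `^ p) + C * ((a `^ p + b `^ p) / 2).
Proof.
(* The threshold is [t ^ p = 1 - e], cut at [0] when [e > 1]; [th] is its root. *)
move=> e0; pose s := Num.max 0 (1 - e).
have s0 : 0 <= s by rewrite le_max lexx.
have s1 : s < 1 by rewrite gt_max ltr01 /=; lra.
move thE : (s `^ p^-1) => th.
have th1 : th < 1.
  rewrite -thE -[ltRHS](congr1 (@^~ p^-1) (@powR1 R)).
  by apply: gt0_ltr_powR; rewrite ?nnegrE ?invr_gt0.
have th0 : 0 <= th by rewrite -thE powR_ge0.
(* The inverse of the midpoint of [1] and [th], hence the smallest [2 / (1 + t)] for [0 <= t <= th];
   [B] is the tangent gap there. *)
pose y0 := 2 / (1 + th).
have y01 : 1 < y0 by rewrite /y0 ltr_pdivlMr; lra.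
pose B := y0 `^ p - 1 - p * (y0 - 1).
have B0 : 0 < B.
  have := @powR_gt_tangent1 y0; rewrite gt_eqF// => /(_ _ isT).
  by rewrite /B => H; have := H ltac:(lra); lra.
pose d := (1 / 2) `^ p * (B / 2).
have d0 : 0 < d by rewrite mulr_gt0 ?powR_gt0 ?divr_gt0.
have di0 : 0 < d^-1 by rewrite invr_gt0.
exists d^-1 => [|a b a0 b0]; first exact: ltW.
have mid := powR_midpoint_le a0 b0.
have ap : 0 <= a `^ p by exact: powR_ge0.
have bp : 0 <= b `^ p by exact: powR_ge0.
have mid' := ler_wpM2l (ltW di0) mid.
have [ba|ab] := leP (b `^ p) (a `^ p); first by nra.
have b0' : 0 < b.
  by rewrite lt_def b0 andbT; apply/eqP => b0'; move: ab; rewrite b0'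
    powR0 ?gt_eqF// ltNge powR_ge0.
pose t := a / b.
have t0 : 0 <= t by rewrite divr_ge0.
have aE : a = b * t by rewrite mulrCA divff ?mulr1 ?gt_eqF.
have apE : a `^ p = b `^ p * t `^ p by rewrite aE powRM.
(* If [1 - t ^ p <= e], then [b ^ p - a ^ p <= e * b ^ p] is absorbed by the [e] term; otherwise the
   midpoint defect is at least [d * b ^ p]. *)
have [tE|tE] := leP (1 - t `^ p) e; first by nra.
have tth : t <= th.
  have -> : t = (t `^ p) `^ p^-1 by rewrite -powRrM divff ?gt_eqF ?powRr1.
  rewrite -thE; apply: ge0_ler_powR.
  all: rewrite ?nnegrE ?powR_ge0 ?invr_ge0 ?(ltW p0)//.
  by rewrite le_max; apply/orP; right; lra.
have yy : y0 <= 2 / (1 + t).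
  by apply: ler_wpM2l => //; rewrite lef_pV2 ?posrE; lra.
have := powR_tangent1_mono (ltW y01) yy; rewrite -/B => H1.
have c2 : (1 / 2) `^ p <= ((1 + t) / 2) `^ p.
  by apply: ge0_ler_powR; rewrite ?nnegrE ?(ltW p0)//; lra.
have H2 := powR_midpoint_gap t0.
have H3 : d <= (1 + t `^ p) / 2 - ((1 + t) / 2) `^ p.
  apply: le_trans H2; apply: ler_pM; rewrite ?powR_ge0 ?divr_ge0 ?(ltW B0)//.
  by rewrite ler_pM2r.
have E : ((a + b) / 2) `^ p = b `^ p * ((1 + t) / 2) `^ p.
  rewrite -powRM//; last by lra.
  by congr (_ `^ _); rewrite aE; lra.
rewrite E apE.
have H4 : b `^ p <= d^-1 * (b `^ p * ((1 + t `^ p) / 2 - ((1 + t) / 2) `^ p)).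
  rewrite mulrCA ler_peMr// mulrC -ler_pdivrMr ?invr_gt0// invrK mul1r//.
have : 0 <= e * (b `^ p * t `^ p + b `^ p) + b `^ p * t `^ p.
  by rewrite addr_ge0 ?mulr_ge0 ?addr_ge0 ?mulr_ge0 ?powR_ge0// ltW.
nra.
Qed.

End power_convexity.

(** * Pointwise operations on real continuous functions *)

Section real_continuous.
Variables (R : realType) (T : topologicalType).
Implicit Types f g : T -> R.

Lemma rcontinuousD f g : continuous f -> continuous g ->
  continuous (fun x => f x + g x).
Proof. by move=> cf cg x; exact: continuousD (cf x) (cg x). Qed.

Lemma rcontinuousB f g : continuous f -> continuous g ->
  continuous (fun x => f x - g x).
Proof. by move=> cf cg x; exact: continuousB (cf x) (cg x). Qed.

Lemma rcontinuousM f g : continuous f -> continuous g ->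
  continuous (fun x => f x * g x).
Proof. by move=> cf cg x; exact: continuousM (cf x) (cg x). Qed.

Lemma rcontinuousZ (t : R) f : continuous f -> continuous (fun x => t * f x).
Proof. by move=> cf; apply: rcontinuousM => //; exact: cst_continuous. Qed.

Lemma rcontinuous_sum (I : Type) (s : seq I) (F : I -> T -> R) :
  (forall i, continuous (F i)) -> continuous (fun x => \sum_(i <- s) F i x).
Proof.
move=> cF; elim: s => [|i s IH].
  have -> : (fun x => \sum_(i <- [::]) F i x) = fun=> 0.
    by apply/funext => x; rewrite big_nil.
  exact: cst_continuous.
have -> : (fun x => \sum_(j <- i :: s) F j x) = (fun x => F i x + \sum_(j <- s) F j x).
  by apply/funext => x; rewrite big_cons.
exact: rcontinuousD.
Qed.

End real_continuous.

(** * The convexity inequality for extended values *)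

Section ereal_power_max.
Variables (R : realType) (p : R).
Hypothesis p1 : 1 < p.
Let p0 : 0 < p. Proof. exact: lt_trans p1. Qed.
Local Open Scope ereal_scope.

(** Only finite arguments call for the real inequality: since [e > 0], an infinite argument makes
    the right-hand side infinite. *)
Lemma poweR_maxe_le (e : R) : (0 < e)%R -> exists2 C : R, (0 <= C)%R &
  forall x y : \bar R, 0 <= x -> 0 <= y ->
  maxe (x `^ p) (y `^ p) + C%:E * (2^-1%:E * (x + y)) `^ p <=
  x `^ p + e%:E * (x `^ p + y `^ p) + C%:E * (2^-1%:E * (x `^ p + y `^ p)).
Proof.
move=> e0; have [C C0 H] := powR_maxr_le p1 e0; exists C => //.
have py : (+oo : \bar R) `^ p = +oo by rewrite poweRyr// gt_eqF.
have RHSy (u v : \bar R) : 0 <= u -> 0 <= v -> u + v = +oo ->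
    u + e%:E * (u + v) + C%:E * (2^-1%:E * (u + v)) = +oo.
  move=> u0 v0 uv; rewrite uv gt0_muley ?lte_fin// addey; last first.
    by rewrite gt_eqF// (lt_le_trans _ u0)// ltNye.
  by rewrite addye// gt_eqF// (@lt_le_trans _ _ 0) ?mule_ge0 ?lee_fin.
move=> [a||] [b||]// a0 b0.
- rewrite -(EFinD a) -(EFinM 2^-1 (a + b)) !poweR_EFin -EFin_max.
  rewrite -(EFinD (a `^ p)) -!EFinM -!EFinD lee_fin.
  by rewrite ![(2^-1 * _)%R]mulrC; exact: H.
- by rewrite RHSy ?leey// ?poweR_ge0// py addey// poweR_EFin.
- by rewrite RHSy ?leey// ?poweR_ge0// py addye// poweR_EFin.
- by rewrite RHSy ?leey// ?poweR_ge0// py.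
Qed.
End ereal_power_max.

Lemma le_poweR2r (R : realType) (r : R) (x y : \bar R) :
  0 <= r -> (0 <= x -> x <= y -> x `^ r <= y `^ r)%E.
Proof.
move=> r0 x0 xy; apply: gt0_ler_poweR => //; rewrite in_itv/= ?x0 ?leey//.
by rewrite (le_trans x0).
Qed.

Lemma poweR_le_root (R : realType) (p : R) (a b : \bar R) : 0 < p ->
  (0 <= a -> 0 <= b -> (a `^ p <= b) = (a <= b `^ p^-1))%E.
Proof.
move=> p0 a0 b0; have pn : p != 0 by rewrite gt_eqF.
apply/idP/idP => ab.
  rewrite -[leLHS]poweRe1// -[X in (_ `^ X <= _)%E](divff pn) poweRrM.
  by apply: le_poweR2r; rewrite ?invr_ge0 ?(ltW p0) ?poweR_ge0.
rewrite -[leRHS]poweRe1// -[X in (_ <= _ `^ X)%E](mulVf pn) poweRrM.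
by apply: le_poweR2r; rewrite ?(ltW p0).
Qed.

(** * Cauchy sequences for the [p]-energy and their majorants *)

Section power_cauchy.
Context d (T : measurableType d) (R : realType).
Variables (mu : {measure set T -> \bar R}) (p : R).
Hypothesis p1 : 1 < p.
Local Open Scope ereal_scope.

Lemma measurable_fun_poweR (f : T -> \bar R) (r : R) :
  measurable_fun [set: T] f -> measurable_fun [set: T] (fun x => f x `^ r).
Proof. by move=> mf; exact: measurableT_comp (measurable_poweR r) mf. Qed.

Ltac nonneg_measurable :=
  solve [ move=> *; repeat first
    [ assumption | exact: measurableT | exact: poweR_ge0 | rewrite le_max; apply/orP; left
    | apply: adde_ge0 | apply: mule_ge0 | by rewrite lee_fin// ltW | by rewrite lee_fin
    | apply: emeasurable_funD | apply: measurable_funeM | apply: measurable_maxe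
    | apply: measurable_fun_poweR ] ].

(** The two terms of the midpoint defect stay on opposite sides, because possibly infinite integrals
    cannot be subtracted. *)
Lemma integral_maxe_le (e : R) : (0 < e)%R -> exists2 C : R, (0 <= C)%R &
  forall f g : T -> \bar R,
  measurable_fun [set: T] f -> measurable_fun [set: T] g ->
  (forall x, 0 <= f x) -> (forall x, 0 <= g x) ->
  \int[mu]_x maxe (f x `^ p) (g x `^ p)
    + C%:E * \int[mu]_x (2^-1%:E * (f x + g x)) `^ p <=
  \int[mu]_x (f x `^ p) + e%:E * (\int[mu]_x (f x `^ p) + \int[mu]_x (g x `^ p))
   + C%:E * (2^-1%:E * (\int[mu]_x (f x `^ p) + \int[mu]_x (g x `^ p))).
Proof.
move=> e0; have [C C0 H] := poweR_maxe_le p1 e0.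
exists C => // f g mf mg f0 g0.
have mfp := measurable_fun_poweR p mf; have mgp := measurable_fun_poweR p mg.
have mfg : measurable_fun setT (fun x => (2^-1%:E * (f x + g x)) `^ p).
  by apply/measurable_fun_poweR/measurable_funeM/emeasurable_funD.
have mD : measurable_fun setT (fun x => f x `^ p + g x `^ p).
  exact: emeasurable_funD.
have D0 x : 0 <= f x `^ p + g x `^ p by rewrite adde_ge0 ?poweR_ge0.
do 5 rewrite -?ge0_integralZl -?ge0_integralD ; try nonneg_measurable.
apply: ge0_le_integral; try nonneg_measurable.
by move=> x _; exact: H.
Qed.

(** A one-sided Cauchy property: it bounds the integral of the positive part of [f k ^ p - f n ^ p]
    without forming the difference. *)
Lemma integral_maxe_cauchy (f : (T -> \bar R)^nat) (L : R) :
  (forall n, measurable_fun [set: T] (f n)) -> (forall n x, 0 <= f n x) ->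
  (forall e : R, (0 < e)%R -> exists N, forall n k, (N <= n)%N -> (n <= k)%N ->
    \int[mu]_x (f n x `^ p) <= (L + e)%:E /\
    (L - e)%:E <= \int[mu]_x (2^-1%:E * (f n x + f k x)) `^ p) ->
  forall e : R, (0 < e)%R -> exists N, forall n k, (N <= n)%N -> (n <= k)%N ->
    \int[mu]_x maxe (f n x `^ p) (f k x `^ p) <= \int[mu]_x (f n x `^ p) + e%:E.
Proof.
(* Both energies will be at most [K], so the factor [e / (4 * K)] costs at most [e / 2]. *)
move=> mf f0 H e e0; pose K := (`|L| + 1)%R.
have K0 : (0 < K)%R by rewrite ltr_wpDl.
have LK : (L + 1 <= K)%R by rewrite lerD2r ler_norm.
have e10 : (0 < e / (4 * K))%R by rewrite divr_gt0// mulr_gt0.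
have [C C0 HC] := integral_maxe_le e10.
(* The midpoint defect is at most [2 * dl], and [2 * C * dl <= e / 2]. *)
pose dl := Num.min 1%R (e / (4 * (C + 1)))%R.
have C1 : (0 < 4 * (C + 1))%R by rewrite mulr_gt0// ltr_wpDl.
have dl0 : (0 < dl)%R by rewrite lt_min ltr01 divr_gt0.
have dl1 : (dl <= 1)%R by rewrite ge_min lexx.
have dlC : (dl * (4 * (C + 1)) <= e)%R.
  by rewrite -ler_pdivlMr// ge_min lexx orbT.
have [N HN] := H _ dl0; exists N => n k Nn nk.
have [In Im] := HN _ _ Nn nk.
have [Ik _] := HN _ _ (leq_trans Nn nk) (leqnn k).
have {HC} := HC _ _ (mf n) (mf k) (f0 n) (f0 k).
have I0 j : 0 <= \int[mu]_x (f j x `^ p).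
  by apply: integral_ge0 => x _; exact: poweR_ge0.
have I1 : 0 <= \int[mu]_x maxe (f n x `^ p) (f k x `^ p).
  by apply: integral_ge0 => x _; rewrite le_max poweR_ge0.
move: In Ik Im (I0 n) (I0 k) I1.
case: (\int[mu]_x (f n x `^ p)) => [a||]//.
case: (\int[mu]_x (f k x `^ p)) => [b||]//.
move: (\int[mu]_x _) => z; move: (\int[mu]_x _) => y.
rewrite -(EFinD a b) -!EFinM -!EFinD !lee_fin => aL bL zL a0 b0 y0 yz.
have : y + C%:E * (L - dl)%:E <=
    (a + e / (4 * K) * (a + b) + C * (2^-1 * (a + b)))%:E.
  apply: le_trans yz; apply: leeD2l.
  by apply: lee_wpmul2l zL; rewrite lee_fin.
case: y y0 {yz} => [y||]// y0; rewrite -EFinM -EFinD !lee_fin.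
have E1 : (e / (4 * K) * (a + b) <= e / 2)%R.
  have : (e / (4 * K) * (a + b) <= e / (4 * K) * (2 * K))%R.
    by apply: ler_wpM2l; [exact: ltW|lra].
  suff -> : (e / (4 * K) * (2 * K) = e / 2)%R by [].
  by field; rewrite gt_eqF.
nra.
Qed.

(* Along a fast subsequence, [\int (max_(j <= k) f_(phi j)) ^ p] increases by at
   most [e / 2 ^ (k + 1)] at each step, because
   [max (S, v) + u <= S + max (u, v)] if [u <= S]. *)
Lemma poweR_cauchy_sup (f : (T -> \bar R)^nat) (L : R) :
  (forall n, measurable_fun [set: T] (f n)) -> (forall n x, 0 <= f n x) ->
  (forall e : R, (0 < e)%R -> exists N, forall n k, (N <= n)%N -> (n <= k)%N ->
    \int[mu]_x (f n x `^ p) <= (L + e)%:E /\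
    (L - e)%:E <= \int[mu]_x (2^-1%:E * (f n x + f k x)) `^ p) ->
  forall e : R, (0 < e)%R -> exists (phi : nat -> nat) (h : T -> \bar R),
    [/\ forall j, (j <= phi j)%N, measurable_fun [set: T] h,
       forall x, 0 <= h x,
       forall j x, f (phi j) x <= h x &
       \int[mu]_x (h x `^ p) <= (L + e)%:E].
Proof.
move=> mf f0 H e e0.
(* Half of [e] pays for the first term [u 0], the other half for all increments together. *)
have e4 : (0 < e / 2)%R by rewrite divr_gt0.
have es j : (0 < e / 2 / 2 ^+ j.+1)%R by rewrite divr_gt0// exprn_gt0.
have /choice[N HN] j := integral_maxe_cauchy mf f0 H (es j).
have [N0 HN0] := H _ e4.
pose phi := fix phi j := if j is i.+1 then maxn (phi i).+1 (N i.+1)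
                         else maxn N0 (N 0%N).
have phiN j : (N j <= phi j)%N by case: j => [|j] /=; exact: leq_maxr.
have phiS j : (phi j <= phi j.+1)%N.
  by rewrite /= (leq_trans (leqnSn _))// leq_maxl.
have phij j : (j <= phi j)%N.
  by elim: j => // j IH; rewrite /= (leq_ltn_trans IH)// leq_maxl.
pose u j x := f (phi j) x `^ p.
pose S := fix S j := if j is i.+1 then fun x => maxe (S i x) (u i.+1 x) else u 0%N.
have mu_ j : measurable_fun [set: T] (u j) by exact: measurable_fun_poweR.
have u0 j x : 0 <= u j x by exact: poweR_ge0.
have mS j : measurable_fun [set: T] (S j).
  by elim: j => [|j IH] //=; exact: measurable_maxe.
have uS j x : u j x <= S j x by case: j => [|j] //=; rewrite le_max lexx orbT.
have S0 j x : 0 <= S j x by exact: le_trans (u0 j x) (uS j x).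
have SS x : {homo S^~ x : n m / (n <= m)%N >-> (n <= m)%E}.
  by apply: homo_leq => // [? ? ?|j]; [exact: le_trans|rewrite /= le_max lexx].
have Ifin j : \int[mu]_x u j x \is a fin_num.
  rewrite ge0_fin_numE ?integral_ge0//.
  have [|+ _] := HN0 (phi j) (phi j) _ (leqnn _).
    by elim: j => [|j IH]; [exact: leq_maxl|exact: leq_trans (phiS j)].
  by move=> /le_lt_trans; apply; exact: ltry.
have IS j : \int[mu]_x S j x <= \int[mu]_x u 0%N x + (e / 2 * (1 - (2 ^+ j)^-1))%:E.
  elim: j => [|j IH]; first by rewrite expr0 invr1 subrr mulr0 adde0.
  rewrite -(leeD2rE _ _ (Ifin j)).
  have : \int[mu]_x S j.+1 x + \int[mu]_x u j x <=
      \int[mu]_x S j x + \int[mu]_x maxe (u j x) (u j.+1 x).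
    rewrite -!ge0_integralD//; last 2 first.
    - by move=> x _; rewrite le_max u0.
    - exact: measurable_maxe.
    apply: ge0_le_integral => //.
    - by move=> x _; rewrite adde_ge0.
    - exact: emeasurable_funD.
    - by apply: emeasurable_funD => //; exact: measurable_maxe.
    move=> x _ /=; have [SE|SE] := leP (S j x) (u j.+1 x).
      by rewrite addeC leeD// le_max lexx orbT.
    by rewrite leeD// le_max lexx.
  move=> /le_trans; apply.
  have := HN _ _ _ (phiN j) (phiS j) => /(leeD IH) /le_trans; apply.
  rewrite addeACA [leRHS]addeAC; apply: leeD => //.
  by rewrite -EFinD lee_fin exprS invfM; lra.
pose h x := (limn (S ^~ x)) `^ p^-1.
have cS x : cvgn (S ^~ x) by exact: ereal_nondecreasing_is_cvgn (SS x).
have Sl j x : S j x <= limn (S ^~ x) by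
  rewrite (cvg_lim _ (ereal_nondecreasing_cvgn (SS x)))//;
  apply: ereal_sup_ubound; exists j.
have l0 x : 0 <= limn (S ^~ x) by exact: le_trans (S0 0%N x) (Sl 0%N x).
have p0 : (0 < p)%R by exact: lt_trans p1.
have hK x : h x `^ p = limn (S ^~ x).
  by rewrite /h -poweRrM mulVf ?gt_eqF// poweRe1.
exists phi, h; split => //.
- by apply: measurable_fun_poweR; exact: (emeasurable_fun_cvg S).
- by move=> x; exact: poweR_ge0.
- move=> j x; rewrite -[leLHS]poweRe1// -[1%R](divff (negbT (gt_eqF p0))) poweRrM.
  apply: le_poweR2r; rewrite ?invr_ge0 ?(ltW p0) ?poweR_ge0//.
  exact: le_trans (uS j x) (Sl j x).
- under eq_integral do rewrite hK.
  rewrite monotone_convergence//; apply: lime_le.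
    apply: ereal_nondecreasing_is_cvgn => i j ij.
    by apply: ge0_le_integral => // x _; exact: SS.
  apply: nearW => j; apply: le_trans (IS j) _.
  have [|+ _] := HN0 (phi 0%N) (phi 0%N) _ (leqnn _); first exact: leq_maxl.
  move=> /leeD2r /le_trans; apply; rewrite -EFinD lee_fin.
  have : (0 <= (2 ^+ j)^-1 :> R)%R by rewrite invr_ge0 exprn_ge0.
  nra.
Qed.
End power_cauchy.

(** * Continuity of the modulus along increasing sequences *)

Section modulus_from_below.
Variables (R : realType) (X : ptopologicalType) (m : Mplus R X) (p : R).
Local Open Scope ereal_scope.

Lemma Modp_ge0 (S : set (Mplus R X)) : 0 <= Modp m p S.
Proof.
by apply/ereal_infP => _ [f _ <-]; apply: integral_ge0 => x _; exact: poweR_ge0.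
Qed.

Lemma le_Modp (A B : set (Mplus R X)) : A `<=` B -> Modp m p A <= Modp m p B.
Proof.
move=> AB; apply: ereal_inf_le_tmp => _ [f [fL fB] <-]; exists f => //.
by split=> // mu /AB /fB.
Qed.

Lemma Modp_le (S : set (Mplus R X)) (f : borel X -> \bar R) :
  measurable_fun [set: borel X] f -> (forall x, 0 <= f x) ->
  (forall mu, S mu -> 1 <= \int[mu]_x f x) ->
  Modp m p S <= \int[m]_x (f x `^ p).
Proof.
move=> mf f0 fS.
have [fy|] := ltP (\int[m]_x (f x `^ p)) +oo; last by apply: le_trans; exact: leey.
by apply: ereal_inf_lbound; exists f.
Qed.

Hypothesis p1 : (1 < p)%R.

(** For [n <= k] the midpoint of [f n] and [f k] is tested on the smaller set [A n]; this suffices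
    because [Modp (A n)] is already within [e] of the supremum [M] for large [n]. *)
Lemma Modp_bigcup (A : nat -> set (Mplus R X)) :
  (forall n, A n `<=` A n.+1) ->
  Modp m p (A n) @[n --> \oo] --> Modp m p (\bigcup_n A n).
Proof.
move=> AS.
have Amono : {homo A : i j / (i <= j)%N >-> i `<=` j}.
  by apply: homo_leq => // [? ?|? ? ?]; [exact: subset_refl|exact: subset_trans].
have ndM : {homo (fun n => Modp m p (A n)) : i j / (i <= j)%N >-> i <= j}.
  by move=> i j ij; apply/le_Modp/Amono.
suff <- : ereal_sup (range (fun n => Modp m p (A n))) = Modp m p (\bigcup_n A n).
  exact: ereal_nondecreasing_cvgn.
apply/eqP; rewrite eq_le; apply/andP; split.
  by apply/ereal_supP => _ [n _ <-]; apply: le_Modp => mu Amu; exists n.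
set M := ereal_sup _.
have MA n : Modp m p (A n) <= M by apply: ereal_sup_ubound; exists n.
have M0 : 0 <= M := le_trans (Modp_ge0 _) (MA 0%N).
have [My|My] := ltP M +oo; last by apply: le_trans My; rewrite leey.
have Mfin : M \is a fin_num by rewrite ge0_fin_numE.
pose L := fine M; have ML : M = L%:E by rewrite fineK.
have en n : (0 < n.+1%:R^-1 :> R)%R by rewrite invr_gt0.
have /choice[f Hf] n : exists f : borel X -> \bar R,
    [/\ Lplus m p f, forall mu, A n mu -> 1 <= \int[mu]_x f x &
     \int[m]_x (f x `^ p) < M + n.+1%:R^-1%:E].
  have : Modp m p (A n) < M + n.+1%:R^-1%:E.
    by rewrite (le_lt_trans (MA n))// lteDl.
  by move=> /ereal_inf_lt[_ [f [fL fA] <-] ff]; exists f.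
have mf n : measurable_fun [set: borel X] (f n) by have [[]] := Hf n.
have f0 n x : 0 <= f n x by have [[_ /(_ x)]] := Hf n.
have fA n mu : A n mu -> 1 <= \int[mu]_x f n x by have [_ /(_ mu)] := Hf n.
have HC (e : R) : (0 < e)%R -> exists N, forall n k, (N <= n)%N -> (n <= k)%N ->
    \int[m]_x (f n x `^ p) <= (L + e)%:E /\
    (L - e)%:E <= \int[m]_x (2^-1%:E * (f n x + f k x)) `^ p.
  move=> e0.
  have [_ [N1 _ <-] HN1] : exists2 x, range (fun n => Modp m p (A n)) x & M - e%:E < x.
    exact: ub_ereal_sup_adherent.
  have [N2 HN2] : exists N2, (N2.+1%:R^-1 <= e)%R.
    exists (Num.truncn e^-1); rewrite invf_ple ?posrE//.
    by rewrite ltW// truncnS_gt.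
  exists (maxn N1 N2) => n k; rewrite geq_max => /andP[N1n N2n] nk; split.
    have [_ _ /ltW /le_trans] := Hf n; apply; rewrite ML -EFinD lee_fin lerD2l.
    by apply: le_trans HN2; rewrite lef_pV2 ?posrE// ler_nat.
  rewrite EFinB -ML (le_trans (ltW HN1))//; apply: (le_trans (ndM _ _ N1n)).
  apply: Modp_le.
  - by apply: measurable_funeM; exact: emeasurable_funD.
  - by move=> x; rewrite mule_ge0 ?adde_ge0.
  move=> mu Anmu; rewrite ge0_integralZl//; last 2 first.
    exact: emeasurable_funD.
    by move=> *; rewrite adde_ge0.
  rewrite ge0_integralD//; have H1 := fA _ _ Anmu.
  have H2 := fA _ _ (Amono _ _ nk _ Anmu).
  rewrite -[leLHS](_ : 2^-1%:E * (1 + 1) = _); last first.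
    by rewrite -EFinD -EFinM; congr EFin; lra.
  by apply: lee_wpmul2l => //; exact: leeD.
apply/lee_addgt0Pr => e e0.
have [phi [h [phij mh h0 fh Ih]]] := poweR_cauchy_sup p1 mf f0 HC e0.
apply: le_trans (_ : \int[m]_x (h x `^ p) <= _); last by rewrite ML -EFinD.
apply: Modp_le => // mu [n _ Anmu].
apply: le_trans (fA (phi n) mu _) _; first by apply: Amono Anmu; exact: phij.
by apply: ge0_le_integral.
Qed.
End modulus_from_below.

(** * The Hahn-Banach theorem *)

Section sublinear_minimal.
Variables (R : realType) (V : lmodType R) (B : set V).
Hypothesis BD : forall x y, B x -> B y -> B (x + y).
Hypothesis BZ : forall (t : R) x, B x -> B (t *: x).

(** [B] acts as a subspace: in the application [V] consists of all functions and [B] of the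
    continuous ones. The inequality for scaling implies equality, by scaling back with [t^-1]. *)
Definition sublinear_on (q : V -> R) :=
  (forall x y, B x -> B y -> q (x + y) <= q x + q y) /\
  (forall (t : R) x, 0 <= t -> B x -> q (t *: x) <= t * q x).

Let BN x : B x -> B (- x). Proof. by rewrite -scaleN1r; exact: BZ. Qed.

Lemma sublinear_on0 q x : sublinear_on q -> B x -> q 0 = 0.
Proof.
move=> [qD qZ] Bx; have B0 : B 0 by rewrite -(scale0r x); exact: BZ.
apply/eqP; rewrite eq_le; apply/andP; split.
  by have := qZ 0 0 (lexx 0) B0; rewrite scale0r mul0r.
by have := qD 0 0 B0 B0; rewrite addr0 -subr_ge0 addrK.
Qed.

Lemma sublinear_onZ q t x : sublinear_on q -> 0 <= t -> B x ->
  q (t *: x) = t * q x.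
Proof.
move=> sq; have [qD qZ] := sq; rewrite le_eqVlt => /predU1P[<- Bx|t0 Bx].
  by rewrite scale0r mul0r (sublinear_on0 sq Bx).
apply/eqP; rewrite eq_le qZ ?(ltW t0)//=.
have ti : 0 <= t^-1 by rewrite invr_ge0 ltW.
have := qZ t^-1 (t *: x) ti (BZ t Bx).
by rewrite scalerA mulVf ?gt_eqF// scale1r ler_pdivlMl.
Qed.

Lemma sublinear_on_ge q x y : sublinear_on q -> B x -> B y ->
  q x - q (- y) <= q (x + y).
Proof.
move=> [qD _] Bx By; rewrite lerBlDr.
by have := qD (x + y) (- y) (BD Bx By) (BN By); rewrite addrK.
Qed.

(* A pointwise minimal sublinear functional [q] is additive: it is not larger
   than the sublinear functional [x |-> inf_(t >= 0) (q (x + t a) - t q a)]. *)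
Lemma hahn_banach (S : V -> R) : sublinear_on S ->
  exists L : V -> R,
  [/\ forall x y, B x -> B y -> L (x + y) = L x + L y,
     forall t x, B x -> L (t *: x) = t * L x &
     forall x, B x -> L x <= S x].
Proof.
move=> sS.
pose T := {q : V -> R | sublinear_on q /\ forall x, B x -> q x <= S x}.
(* This common lower bound keeps the pointwise infimum of a chain finite. *)
have Tlb (q : T) x : B x -> - S (- x) <= sval q x.
  case: q => q [sq qS] Bx /=; have B0 : B 0 by rewrite -(scale0r x); exact: BZ.
  have := sublinear_on_ge sq B0 Bx; rewrite add0r (sublinear_on0 sq Bx).
  have := qS _ (BN Bx); lra.
(* The order is reversed, so that Zorn's lemma yields a minimal functional. It is only a preorder,
   values outside [B] being free. *)
pose rel (q r : T) := `[< forall x, B x -> sval r x <= sval q x >].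
have t0 : T by exists S.
have [| | |q qmin] := @ZL_preorder T t0 rel.
- by move=> q; apply/asboolP => x _.
- move=> r q s /asboolP qr /asboolP rs; apply/asboolP => x Bx.
  exact: le_trans (rs _ Bx) (qr _ Bx).
- move=> A Atot; have [->|/set0P[q0 Aq0]] := eqVneq A set0; first by exists t0.
  pose g x := inf [set sval q x | q in A].
  have lbg x : B x -> has_inf [set sval q x | q in A].
    move=> Bx; split; first by exists (sval q0 x), q0.
    by exists (- S (- x)) => _ [q _ <-]; exact: Tlb.
  have gle q x : B x -> A q -> g x <= sval q x.
    by move=> Bx Aq; apply: ge_inf; [exact: (lbg x Bx).2|exists q].
  have gex x e : B x -> 0 < e -> exists2 q, A q & sval q x < g x + e.
    move=> Bx e0; have [_ [q Aq <-] H] := inf_adherent e0 (lbg x Bx).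
    by exists q.
  have sg : sublinear_on g.
    split=> [x y Bx By|t x t0' Bx].
      apply/ler_addgt0Pr => e e0; have e2 : 0 < e / 2 by rewrite divr_gt0.
      have [q Aq Hq] := gex x _ Bx e2; have [r Ar Hr] := gex y _ By e2.
      (* In a chain the smaller of [q] and [r] serves at both [x] and [y], which makes the infimum
         subadditive. *)
      have [s [As sx sy]] : exists s, [/\ A s, sval s x <= sval q x & sval s y <= sval r y].
        by case: (Atot _ _ Aq Ar) => /asboolP H; [exists r|exists q]; split => //;
          exact: H.
      have := gle s _ (BD Bx By) As; have := (svalP s).1.1 _ _ Bx By; lra.
    have [->|tn0] := eqVneq t 0.
      rewrite scale0r mul0r; have B0 : B 0 by rewrite -(scale0r x); exact: BZ.
      by have := gle q0 _ B0 Aq0; rewrite (sublinear_on0 (svalP q0).1 Bx).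
    have tp : 0 < t by rewrite lt_def tn0.
    rewrite -ler_pdivrMl//; apply: lb_le_inf; first exact: (lbg x Bx).1.
    move=> _ [q Aq <-]; rewrite ler_pdivrMl//.
    by rewrite (le_trans (gle q _ (BZ t Bx) Aq))// (svalP q).1.2.
  have gS x : B x -> g x <= S x.
    by move=> Bx; rewrite (le_trans (gle q0 _ Bx Aq0))// (svalP q0).2.
  exists (exist _ g (conj sg gS)) => q Aq; apply/asboolP => x Bx /=.
  exact: gle.
have [sq qS] := svalP q; set f := sval q in sq qS.
have fD a x : B a -> B x -> f (x + a) = f x + f a.
  move=> Ba Bx; apply/eqP; rewrite eq_le sq.1//=.
  pose E y := [set f (y + t *: a) - t * f a | t in [set t | 0 <= t]].
  have lbE y : B y -> has_inf (E y).
    move=> By; split; first by exists (f (y + 0 *: a) - 0 * f a); exists 0 => /=.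
    exists (- f (- y)) => _ [t /= t0' <-].
    have := sublinear_on_ge sq (BZ t Ba) By.
    by rewrite addrC (sublinear_onZ sq)//; rewrite [t *: a + y]addrC; lra.
  have gle y t : B y -> 0 <= t -> inf (E y) <= f (y + t *: a) - t * f a.
    by move=> By t0'; apply: ge_inf; [exact: (lbE y By).2|exists t].
  have gle0 y : B y -> inf (E y) <= f y.
    by move=> By; have := gle y 0 By (lexx _); rewrite scale0r addr0 mul0r subr0.
  have sE : sublinear_on (fun y => inf (E y)).
    split=> [y z By Bz|t y t0' By].
      apply/ler_addgt0Pr => e e0; have e2 : 0 < e / 2 by rewrite divr_gt0.
      have [_ [s /= s0 <-] Hs] := inf_adherent e2 (lbE y By).
      have [_ [t /= t0' <-] Ht] := inf_adherent e2 (lbE z Bz).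
      have := gle (y + z) (s + t) (BD By Bz) (addr_ge0 s0 t0').
      rewrite scalerDl addrACA.
      have := sq.1 _ _ (BD By (BZ s Ba)) (BD Bz (BZ t Ba)); lra.
    have [->|tn0] := eqVneq t 0.
      rewrite scale0r mul0r; have B0 : B 0 by rewrite -(scale0r y); exact: BZ.
      by have := gle0 _ B0; rewrite (sublinear_on0 sq By).
    have tp : 0 < t by rewrite lt_def tn0.
    rewrite -ler_pdivrMl//; apply: lb_le_inf; first exact: (lbE y By).1.
    move=> _ [s /= s0 <-]; rewrite ler_pdivrMl//.
    have := gle (t *: y) (t * s) (BZ t By) (mulr_ge0 t0' s0).
    rewrite -scalerA -scalerDr.
    have := sq.2 t _ t0' (BD By (BZ s Ba)); rewrite mulrBr mulrA; lra.
  have ES y : B y -> inf (E y) <= S y.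
    by move=> By; rewrite (le_trans (gle0 _ By))// qS.
  have /qmin/asboolP/(_ x Bx) /= H : rel q (exist _ _ (conj sE ES)).
    by apply/asboolP => y By /=; exact: gle0.
  have := gle x 1 Bx ler01; rewrite scale1r mul1r -/f in H *; lra.
exists f; split => // [x y Bx By|t x Bx]; first exact: fD.
have [t0'|t0'] := leP 0 t; first exact: sublinear_onZ.
have fN y : B y -> f (- y) = - f y.
  move=> By; have := fD (- y) y (BN By) By; rewrite subrr (sublinear_on0 sq By).
  lra.
rewrite -[t]opprK scaleNr fN ?(sublinear_onZ sq) ?mulNr//; last exact: BZ.
by rewrite oppr_ge0 ltW.
Qed.
End sublinear_minimal.

(** * Borel measurability from the topology *)

Section borel_sets.
Variables (R : realType) (E : ptopologicalType).

Lemma open_borel_measurable (U : set E) : open U -> measurable (U : set (borel E)).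
Proof. by move=> oU; exact: sub_sigma_algebra. Qed.

Lemma closed_borel_measurable (A : set E) : closed A -> measurable (A : set (borel E)).
Proof.
move=> cA; rewrite -[A]setCK; apply: measurableC.
by apply: open_borel_measurable; exact: closed_openC.
Qed.

Lemma continuous_borel_measurable (f : E -> R) : continuous f ->
  measurable_fun [set: borel E] (f : borel E -> R).
Proof.
move=> /continuousP cf; apply: (measurability _ (RGenOpens.measurableE R)).
move=> _ [_ [a [b ->] <-]]; rewrite setTI; apply: open_borel_measurable.
exact/cf/interval_open.
Qed.

End borel_sets.

(** * Riesz representation of a positive functional carried by a compact set *)

Section representing_measure.
Variables (R : realType) (E : ptopologicalType) (S : set E).
Variable L : (E -> R) -> R.
Hypothesis LD : forall f g : E -> R, continuous f -> continuous g ->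
  L (f \+ g) = L f + L g.
Hypothesis LZ : forall (t : R) (f : E -> R), continuous f -> L (fun x => t * f x) = t * L f.
Hypothesis L_le0 : forall f : E -> R, continuous f -> (forall x, S x -> f x <= 0) ->
  L f <= 0.
Hypothesis L1 : L (fun=> 1) = 1.

Let cst_cont (c : R) : continuous (fun _ : E => c).
Proof. exact: cst_continuous. Qed.
Let D_cont (f g : E -> R) : continuous f -> continuous g -> continuous (f \+ g).
Proof. by move=> cf cg x; exact: continuousD (cf x) (cg x). Qed.
Let M_cont (f g : E -> R) : continuous f -> continuous g -> continuous (f \* g).
Proof. by move=> cf cg x; exact: continuousM (cf x) (cg x). Qed.
Let LB (f g : E -> R) : continuous f -> continuous g -> L (fun x => f x - g x) = L f - L g.
Proof.
move=> cf cg; have := LD cf (rcontinuousZ (t := -1) cg); rewrite LZ// mulN1r => <-.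
by congr L; apply/funext => x /=; rewrite mulN1r.
Qed.

Let L_le (f g : E -> R) : continuous f -> continuous g ->
  (forall x, S x -> f x <= g x) -> L f <= L g.
Proof.
move=> cf cg fg; rewrite -subr_le0 -LB//; apply: L_le0.
  exact: rcontinuousB.
by move=> x Sx; rewrite subr_le0 fg.
Qed.

Let L0 : L (fun=> 0) = 0.
Proof.
rewrite -[RHS](mul0r (L (fun=> 0))) -LZ; last exact: cst_cont.
by congr L; apply/funext => x; rewrite mul0r.
Qed.

Let L_ge0 (f : E -> R) : continuous f -> (forall x, S x -> 0 <= f x) -> 0 <= L f.
Proof. by move=> cf f0; rewrite -L0; exact: L_le. Qed.

Let sum_cont (f : nat -> E -> R) n : (forall i, continuous (f i)) ->
  continuous (fun x => \sum_(i < n) f i x).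
Proof.
move=> cf; elim: n => [|n IH].
  have -> : (fun x => \sum_(i < 0) f i x) = fun=> 0.
    by apply/funext => x; rewrite big_ord0.
  exact: cst_cont.
have -> : (fun x => \sum_(i < n.+1) f i x) = (fun x => \sum_(i < n) f i x) \+ f n.
  by apply/funext => x; rewrite big_ord_recr.
exact: (D_cont IH (cf n)).
Qed.

Let L_sum (f : nat -> E -> R) n : (forall i, continuous (f i)) ->
  L (fun x => \sum_(i < n) f i x) = \sum_(i < n) L (f i).
Proof.
move=> cf; elim: n => [|n IH].
  by rewrite big_ord0 -[RHS]L0; congr L; apply/funext => x; rewrite big_ord0.
rewrite big_ord_recr/= -IH -(LD (@sum_cont f n cf) (cf n)).
by congr L; apply/funext => x /=; rewrite big_ord_recr.
Qed.

(* Upward directed families, rather than increasing sequences, of continuous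
   functions make every open set measurable without any countability
   assumption on the topology of [E]. *)
Definition directed_cover (A : set E) (D : set (E -> R)) : Prop :=
  [/\ forall f, D f -> continuous f /\ forall x, 0 <= f x,
      forall f g, D f -> D g ->
        exists2 h, D h & forall x, f x <= h x /\ g x <= h x,
      D !=set0 &
      forall x (e : R), A x -> S x -> 0 < e -> exists2 f, D f & 1 - e < f x].

Local Open Scope ereal_scope.

Definition sup_functional (D : set (E -> R)) : \bar R :=
  ereal_sup [set (L f)%:E | f in D].

(** The upper integral of an indicator: the supremum of the functions in [D] is lower semicontinuous
    and at least [1] on [A] within [S]. Points outside [S] impose nothing, so the complement of [S]
    is null. *)
Definition radon_outer (A : set E) : \bar R :=
  ereal_inf [set sup_functional D | D in directed_cover A].

Lemma sup_functional_ge0 A D : directed_cover A D -> 0 <= sup_functional D.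
Proof.
move=> [Dc _ [f Df] _]; apply: le_ereal_sup_tmp; exists (L f)%:E; first by exists f.
by have [cf f0] := Dc _ Df; rewrite lee_fin; apply: L_ge0.
Qed.

Lemma le_sup_functional (D : set (E -> R)) f : D f -> (L f)%:E <= sup_functional D.
Proof. by move=> Df; apply: ereal_sup_ubound; exists f. Qed.

Lemma radon_outer_le A D : directed_cover A D -> radon_outer A <= sup_functional D.
Proof. by move=> DA; apply: ereal_inf_lbound; exists D. Qed.

Lemma radon_outer_ge0 A : 0 <= radon_outer A.
Proof. by apply/ereal_infP => _ [D /sup_functional_ge0 D0 <-]. Qed.

Lemma directed_cover_single A (f : E -> R) : continuous f -> (forall x, (0 <= f x)%R) ->
  (forall x, A x -> S x -> (1 <= f x)%R) -> directed_cover A [set f].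
Proof.
move=> cf f0 fA; split.
- by move=> _ ->.
- by move=> _ _ -> ->; exists f.
- by exists f.
- move=> x e Ax Sx e0; exists f => //; have := fA _ Ax Sx; lra.
Qed.

Lemma radon_outer_le_single A (f : E -> R) : continuous f -> (forall x, (0 <= f x)%R) ->
  (forall x, A x -> S x -> (1 <= f x)%R) -> radon_outer A <= (L f)%:E.
Proof.
move=> cf f0 fA; apply: le_trans (radon_outer_le (directed_cover_single cf f0 fA)) _.
by apply/ereal_supP => _ [_ -> <-].
Qed.

Lemma radon_outer0 : radon_outer set0 = 0.
Proof.
apply/eqP; rewrite eq_le radon_outer_ge0 andbT -[leRHS]/(0%R%:E) -L0.
exact: radon_outer_le_single.
Qed.

Lemma radon_outerC : radon_outer (~` S) = 0.
Proof.
apply/eqP; rewrite eq_le radon_outer_ge0 andbT -[leRHS]/(0%R%:E) -L0.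
exact: radon_outer_le_single.
Qed.

Lemma le_radon_outer : {homo radon_outer : A B / A `<=` B >-> A <= B}.
Proof.
move=> A B AB; apply/ereal_infP => _ [D [D1 D2 D3 D4] <-].
apply: radon_outer_le; split => // x e Ax; exact: D4 (AB _ Ax).
Qed.

Lemma radon_outer_sigma_subadditive : sigma_subadditive radon_outer.
Proof.
move=> F; set s := (X in _ <= X).
have s0 : 0 <= s by apply: nneseries_ge0 => n _ _; exact: radon_outer_ge0.
have [sy|] := ltP s +oo; last by rewrite leye_eq => /eqP ->; rewrite leey.
have Ffin n : radon_outer (F n) \is a fin_num.
  rewrite ge0_fin_numE ?radon_outer_ge0//; apply: le_lt_trans sy.
  apply: le_trans (nneseries_lim_ge n.+1 _); last first.
    by move=> *; exact: radon_outer_ge0.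
  rewrite big_nat_recr//= leeDr// sume_ge0// => *; exact: radon_outer_ge0.
apply/lee_addgt0Pr => e e0.
have en n : (0 < e / (2 ^ n.+1)%:R)%R by rewrite divr_gt0// ltr0n expn_gt0.
have /choice[D DF] n : exists D, directed_cover (F n) D /\
    sup_functional D <= radon_outer (F n) + (e / (2 ^ n.+1)%:R)%:E.
  have [_ [D DF <-] H] := lb_ereal_inf_adherent (en n) (Ffin n).
  by exists D; split => //; exact: ltW.
(* Finite partial sums replace the infinite sum, which need not be continuous; they are directed
   because lengthening a sum of nonnegative terms increases it. *)
pose DD := [set (fun x => \sum_(i < kf.1) kf.2 i x)%R |
  kf in [set kf : nat * (nat -> E -> R) | forall i, D i (kf.2 i)]].
have D3 i : exists f, D i f by have [[_ _ [f Df] _] _] := DF i; exists f.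
have [d Dd] := choice D3.
have Dc i f : D i f -> continuous f by have [[H _ _ _] _ /H[]] := DF i.
have Dp i f x : D i f -> (0 <= f x)%R.
  by have [[H _ _ _] _ /H[_]] := DF i; exact.
have DDF : directed_cover (\bigcup_n F n) DD.
  split.
  - move=> _ [[k f] /= Df <-]; split; first by apply: sum_cont => i; exact: Dc (Df i).
    by move=> x; apply: sumr_ge0 => i _; exact: Dp (Df i).
  - move=> _ _ [[k f] /= Df <-] [[l g] /= Dg <-].
    have /choice[h Dh] i : exists h, D i h /\ forall x, (f i x <= h x /\ g i x <= h x)%R.
      by have [[_ H _ _] _] := DF i; have [h Dh hx] := H _ _ (Df i) (Dg i); exists h.
    exists (fun x => \sum_(i < maxn k l) h i x)%R.
      by exists (maxn k l, h) => //= i; exact: (Dh i).1.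
    have W q (u : nat -> E -> R) x : (q <= maxn k l)%N ->
        (forall i, (u i x <= h i x)%R) ->
        (\sum_(i < q) u i x <= \sum_(i < maxn k l) h i x)%R.
      move=> qkl uh; rewrite (big_ord_widen (maxn k l) (fun i => u i x))//.
      rewrite [leRHS](bigID (fun i : 'I_(maxn k l) => (i < q)%N))/= -[leLHS]addr0.
      apply: lerD; first by apply: ler_sum => i _; exact: uh.
      by apply: sumr_ge0 => i _; exact: Dp (Dh i).1.
    move=> x; split; apply: W; rewrite ?leq_maxl ?leq_maxr// => i.
      by have [_ /(_ x)[]] := Dh i.
    by have [_ /(_ x)[]] := Dh i.
  - by exists (fun x => \sum_(i < 0) d i x)%R, (0%N, d).
  - move=> x a [n _ Fnx] Sx a0; have [[_ _ _ /(_ x a Fnx Sx a0)[f Df fx]] _] := DF n.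
    (* The term [f] alone exceeds [1 - a] at [x]; the members [d i] merely fill the earlier
       positions. *)
    exists (fun x => \sum_(i < n.+1) (if i == n :> nat then f else d i) x)%R.
      exists (n.+1, fun i => if i == n then f else d i) => //= i.
      by case: eqVneq => [->|].
    rewrite big_ord_recr/= eqxx (lt_le_trans fx)// lerDr sumr_ge0// => i _.
    by case: eqVneq => [_|_]; [exact: Dp Df|exact: Dp (Dd i)].
apply: le_trans (radon_outer_le DDF) _.
apply: le_trans (epsilon_trick _ _ (ltW e0)); last by move=> *; exact: radon_outer_ge0.
apply/ereal_supP => _ [_ [[k f] /= Df <-] <-].
rewrite L_sum; last by move=> i; exact: Dc (Df i).
apply: le_trans (nneseries_lim_ge k _); last first.
  by move=> *; rewrite adde_ge0 ?radon_outer_ge0// lee_fin ltW.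
rewrite big_mkord -sumEFin; apply: lee_sum => i _.
by rewrite (le_trans _ (DF i).2)// le_sup_functional.
Qed.

Local Open Scope ereal_scope.
HB.instance Definition _ := isOuterMeasure.Build R E radon_outer
  radon_outer0 radon_outer_ge0 le_radon_outer radon_outer_sigma_subadditive.

Hypothesis completely_regular : forall (U : set E) x, open U -> U x ->
  exists f : E -> R, [/\ continuous f, forall y, (0 <= f y <= 1)%R, f x = 1%R &
    forall y, ~ U y -> f y = 0%R].

Lemma directed_cover_mull A U D (g : E -> R) :
  directed_cover A D -> continuous g -> (forall x, (0 <= g x)%R) ->
  (forall x, U x -> g x = 1%R) ->
  directed_cover (A `&` U) [set (f \* g)%R | f in D].
Proof.
move=> [D1 D2 [f0 Df0] D4] cg g0 gU; split.
- by move=> _ [f /D1[cf f0'] <-]; split=> [|x]; [exact: M_cont|exact: mulr_ge0].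
- move=> _ _ [f1 Df1 <-] [f2 Df2 <-]; have [h Dh fh] := D2 _ _ Df1 Df2.
  exists (h \* g)%R; first by exists h.
  by move=> x; have [] := fh x; split; exact: ler_wpM2r.
- by exists (f0 \* g)%R, f0.
- move=> x e [Ax Ux] Sx e0; have [f Df fx] := D4 _ _ Ax Sx e0.
  by exists (f \* g)%R; [exists f|rewrite /= gU// mulr1].
Qed.

(** In general no single continuous cutoff is [1] on [U] and [0] outside. All cutoffs vanishing
    outside [U] are taken, directed by maxima; complete regularity provides one equal to [1] at a
    given point. *)
Lemma directed_cover_mul A U D : open U -> directed_cover A D ->
  directed_cover (A `&` U) [set (fg.1 \* fg.2)%R | fg in
    [set fg : (E -> R) * (E -> R) | D fg.1 /\
      [/\ continuous fg.2, forall x : E, (0 <= fg.2 x <= 1)%R &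
        forall x : E, ~ U x -> fg.2 x = 0%R]]].
Proof.
move=> oU [D1 D2 [f0 Df0] D4]; split.
- move=> _ [[f g]/= [/D1[cf f0'] [cg g01 _]] <-]; split=> [|x]; first exact: M_cont.
  by apply: mulr_ge0 => //; have /andP[] := g01 x.
- move=> _ _ [[f1 g1]/= [Df1 [c1 g101 g1U]] <-] [[f2 g2]/= [Df2 [c2 g201 g2U]] <-].
  have [h Dh fh] := D2 _ _ Df1 Df2.
  exists (h \* (fun x => Num.max (g1 x) (g2 x)))%R.
    exists (h, fun x => Num.max (g1 x) (g2 x)) => //=; split => //; split.
    - by move=> x; apply: continuous_max; [exact: c1|exact: c2].
    - move=> x; have /andP[g10 g11] := g101 x; have /andP[g20 g21] := g201 x.
      by rewrite le_max g10 ge_max g11 g21.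
    - by move=> x Ux; rewrite g1U// g2U// maxxx.
  have [_ h0] := D1 _ Dh.
  move=> x; have [f1h f2h] := fh x; have [_ f10] := D1 _ Df1; have [_ f20] := D1 _ Df2.
  have /andP[g10 g11] := g101 x; have /andP[g20 g21] := g201 x.
  by split; apply: ler_pM; rewrite ?le_max ?lexx ?orbT.
- exists (f0 \* (fun=> 0%R))%R, (f0, fun=> 0%R) => //=; split => //; split => //.
  by move=> x; rewrite lexx ler01.
- move=> x e [Ax Ux] Sx e0; have [f Df fx] := D4 _ _ Ax Sx e0.
  have [g [cg g01 gx gU]] := completely_regular oU Ux.
  by exists (f \* g)%R; [exists (f, g)|rewrite /= gx mulr1].
Qed.

(** Choose [f \* g] nearly optimal for the part inside [U]. As [g] vanishes outside [U], the
    functions [h * (1 - g)] cover the rest of [A], and [f * g + h * (1 - g) <= k] for any [k] in [D]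
    above [f] and [h]. *)
Lemma caratheodory_radon_open U : open U -> caratheodory_measurable radon_outer U.
Proof.
move=> oU; apply: le_caratheodory_measurable => A.
apply/ereal_infP => _ [D DA <-].
set DU := [set (fg.1 \* fg.2)%R | fg in
    [set fg : (E -> R) * (E -> R) | D fg.1 /\
      [/\ continuous fg.2, forall x : E, (0 <= fg.2 x <= 1)%R &
        forall x : E, ~ U x -> fg.2 x = 0%R]]].
have DUA : directed_cover (A `&` U) DU by exact: directed_cover_mul.
have [Dy|] := ltP (sup_functional D) +oo; last by rewrite leye_eq => /eqP ->; rewrite leey.
have [D1 D2 _ _] := DA.
have DUle : sup_functional DU <= sup_functional D.
  apply/ereal_supP => _ [_ [[f g]/= [Df [cg g01 _]] <-] <-].
  apply: le_trans (le_sup_functional Df); rewrite lee_fin; have [cf f0] := D1 _ Df.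
  apply: L_le => // [|x _]; first exact: M_cont.
  by have /andP[_] := g01 x; exact: ler_piMr.
have DUfin : sup_functional DU \is a fin_num.
  by rewrite ge0_fin_numE ?(sup_functional_ge0 DUA)// (le_lt_trans DUle).
apply: (@le_trans _ _ (sup_functional DU + radon_outer (A `&` ~` U))).
  by rewrite leeD2r// radon_outer_le.
apply/lee_addgt0Pr => e e0.
have [_ [_ [[f g]/= [Df [cg g01 gU]] <-] <-] He] := ub_ereal_sup_adherent e0 DUfin.
have DC : directed_cover (A `&` ~` U) [set (h \* (fun x => 1 - g x)%R)%R | h in D].
  apply: directed_cover_mull => //.
  - by apply: rcontinuousB => //; exact: cst_cont.
  - by move=> x; rewrite subr_ge0; have /andP[] := g01 x.
  - by move=> x /gU ->; rewrite subr0.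
apply: le_trans (leeD2l _ (radon_outer_le DC)) _.
rewrite -leeBrDl//; apply/ereal_supP => _ [_ [h Dh <-] <-].
have [k Dk hk] := D2 _ _ Df Dh; have [ch h0] := D1 _ Dh; have [ck k0] := D1 _ Dk.
have [cf f0] := D1 _ Df.
rewrite leeBrDl//.
apply: (@le_trans _ _ ((L (f \* g)%R + e)%:E + (L (h \* (fun x => 1 - g x))%R)%:E)).
  by rewrite leeD2r// EFinD -leeBlDr// ltW.
have := le_sup_functional Dk; rewrite -(leeD2rE _ _ (_ : e%:E \is a fin_num))//.
apply: le_trans; rewrite -!EFinD lee_fin addrAC lerD2r -LD; last 2 first.
- exact: M_cont.
- by apply: M_cont => //; apply: rcontinuousB => //; exact: cst_cont.
apply: L_le => //.
  apply: D_cont; first exact: M_cont.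
  by apply: M_cont => //; apply: rcontinuousB => //; exact: cst_cont.
move=> x _ /=; have /andP[g0 g1] := g01 x; have [fk hk'] := hk x.
have := ler_wpM2r g0 fk.
have : (h x * (1 - g x) <= k x * (1 - g x))%R by apply: ler_wpM2r => //; lra.
lra.
Qed.

Lemma caratheodory_radon_borel (A : set (borel E)) : measurable A ->
  caratheodory_measurable radon_outer A.
Proof.
move: A; apply: smallest_sub; last exact: caratheodory_radon_open.
split=> [|A|F]; first exact: caratheodory_measurable_set0.
  by rewrite setTD; exact: caratheodory_measurable_setC.
exact: caratheodory_measurable_bigcup.
Qed.

Definition radon_measure (A : set (borel E)) : \bar R := radon_outer A.

Lemma radon_measure_semi_sigma_additive : semi_sigma_additive radon_measure.
Proof.
move=> F mF tF mUF; apply: (@caratheodory_measure_sigma_additive R E radon_outer) => //.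
- by move=> i; exact: caratheodory_radon_borel.
- exact: caratheodory_radon_borel.
Qed.

HB.instance Definition _ := isMeasure.Build _ (borel E) R radon_measure
  radon_outer0 radon_outer_ge0 radon_measure_semi_sigma_additive.
Hypothesis compact_S : compact S.

(** Dini's argument for directed families: the members of [D] above a given one generate a filter,
    to which the near-covering form of compactness applies. *)
Lemma directed_cover_compact D (e : R) : directed_cover S D -> (0 < e)%R ->
  exists2 f, D f & forall x, S x -> (1 - e < f x)%R.
Proof.
move=> [D1 D2 [f0 Df0] D4] e0.
pose F := filter_from D (fun f => [set g | D g /\ forall x, (f x <= g x)%R]).
have FF : Filter F.
  apply: filter_from_filter; first by exists f0.
  move=> f g Df Dg; have [h Dh fgh] := D2 _ _ Df Dg; exists h => // k [Dk hk].
  split; split => // x; have [fh gh] := fgh x.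
    exact: le_trans fh (hk x).
  exact: le_trans gh (hk x).
have := compact_S; move=> /compact_near_coveringP.
move=> /(_ _ F (fun f x => (1 - e < f x)%R) FF) [|f Df Hf]; last first.
  by exists f => //; apply: Hf.
move=> x Sx; have [f Df fx] := D4 _ _ Sx Sx e0; have [cf _] := D1 _ Df.
exists ([set y | (1 - e < f y)%R], [set g | D g /\ forall x, (f x <= g x)%R]).
  split; last by exists f.
  apply: open_nbhs_nbhs; split => //.
  by apply: (@open_comp _ _ f [set r | (1 - e < r)%R]) => //; exact: open_gt.
by move=> [y g] /= [fy [_ fg]]; exact: lt_le_trans (fg y).
Qed.

Lemma radon_outer_compact : 1 <= radon_outer S.
Proof.
apply/ereal_infP => _ [D DS <-]; apply/lee_addgt0Pr => e e0.
have [f Df fS] := directed_cover_compact DS e0.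
have [/(_ _ Df)[cf f0] _ _ _] := DS.
apply: le_trans (leeD2r _ (le_sup_functional Df)).
have LE : (L (fun=> (1 - e) * 1) = 1 - e)%R.
  by rewrite LZ ?L1 ?mulr1//; exact: cst_cont.
rewrite -EFinD lee_fin -lerBlDr -LE; apply: L_le => //.
by move=> x /fS /ltW; rewrite mulr1.
Qed.

Lemma radon_measure_setT : radon_measure setT = 1.
Proof.
apply/eqP; rewrite eq_le (le_trans radon_outer_compact (le_radon_outer _))// andbT.
by rewrite -[leRHS]/(1%R%:E) -L1; apply: radon_outer_le_single.
Qed.

HB.instance Definition _ := Measure_isProbability.Build _ (borel E) R
  radon_measure radon_measure_setT.

(** The part of [t] lying between the levels [k] and [k + 1]. *)
Let clip (k : nat) (t : R) : R := (Num.min 1 (Num.max 0 (t - k%:R)))%R.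

Let clip_sum (t : R) n : (0 <= t)%R ->
  (\sum_(k < n) clip k t = Num.min t n%:R)%R.
Proof.
move=> t0; elim: n => [|n IH]; first by rewrite big_ord0 min_r.
rewrite big_ord_recr/= IH /clip -natr1.
have n0 : (0 <= n%:R :> R)%R by [].
rewrite /Num.min /Num.max; do ![case: ifPn => //]; rewrite -?leNgt; lra.
Qed.

Let clip_cont (f : E -> R) k : continuous f -> continuous (clip k \o f).
Proof.
move=> cf x.
apply: (@continuous_min _ _ (fun=> 1%R) (fun x => Num.max 0 (f x - k%:R))%R).
  exact: cst_cont.
apply: (@continuous_max _ _ (fun=> 0%R) (fun x => f x - k%:R)%R).
  exact: cst_cont.
by apply: rcontinuousB => //; exact: cst_cont.
Qed.

(** A layer-cake estimate with step [e]: the set [A k] has measure at most [L] of the [k]-th layer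
    of [f / e], and the layers add up to at most [f / e]. *)
Lemma radon_measure_integral_le (f : E -> R) : continuous f ->
  (forall x, (0 <= f x)%R) -> \int[radon_measure]_x (f x)%:E <= (L f)%:E.
Proof.
move=> cf f0; apply/lee_addgt0Pr => e e0.
have [N SN] : exists N : nat, forall x, S x -> (f x / e <= N%:R)%R.
  have /compact_bounded[M [_ HM]] : compact (f @` S).
    by apply: continuous_compact => //; exact: continuous_subspaceT.
  exists (Num.truncn ((M + 1) / e)).+1 => x Sx; apply: ltW.
  apply: le_lt_trans (truncnS_gt _); rewrite ler_pM2r ?invr_gt0//.
  by apply: le_trans (ler_norm _) _; apply: HM; [rewrite ltrDl|exists x].
have mf := continuous_borel_measurable cf.
pose A k : set (borel E) := [set x | (k.+1%:R <= f x / e)%R].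
pose B : set (borel E) := [set x | (N%:R < f x / e)%R].
have cfe : continuous (fun x => f x / e)%R.
  by apply: M_cont => //; exact: cst_cont.
have mA k : measurable (A k).
  apply: closed_borel_measurable.
  by apply: (@preimage_closed _ _ (fun x => f x / e)%R [set r | (k.+1%:R <= r)%R]);
    [move=> ? _; exact: cfe|exact: closed_ge].
have mB : measurable B.
  apply: open_borel_measurable.
  by apply: (@open_comp _ _ (fun x => f x / e)%R [set r | (N%:R < r)%R]);
    [move=> ? _; exact: cfe|exact: open_gt].
have B0 : radon_measure B = 0.
  apply/eqP; rewrite eq_le radon_outer_ge0 andbT -radon_outerC.
  by apply: le_radon_outer => x Bx Sx; have : (N%:R < f x / e)%R := Bx; rewrite ltNge SN.
have muA k : radon_measure (A k) <= (L (clip k \o (fun x => f x / e)))%:E.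
  apply: radon_outer_le_single.
  - exact: clip_cont.
  - by move=> x; rewrite /= /clip le_min ler01 le_max lexx.
  - move=> x /= Ax _; rewrite /clip le_min lexx/= le_max; apply/orP; right.
    by rewrite lerBrDr addrC natr1.
pose s x := \sum_(k < N) (e * \1_(A k) x)%:E.
(* Outside [S] the quotient [f / e] may exceed [N]; the infinite term takes care of these points and
   integrates to [0]. *)
have ptw (x : borel E) : (f x)%:E <= e%:E + s x + +oo * (\1_B x)%:E.
  rewrite indicE; have [xB|xB] := boolP (x \in B).
    rewrite mule1 addey ?leey// gt_eqF// (@lt_le_trans _ _ 0)//.
    rewrite adde_ge0 ?lee_fin ?(ltW e0)// sume_ge0// => k _.
    by rewrite lee_fin mulr_ge0// ltW.
  rewrite mule0 adde0 /s sumEFin -EFinD lee_fin -mulr_sumr -[X in (X + _)%R]mulr1.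
  rewrite -mulrDr -ler_pdivrMl// mulrC.
  have fe0 : (0 <= f x / e)%R by rewrite divr_ge0// ltW.
  have fN : (f x / e <= N%:R)%R by rewrite leNgt; apply: contra xB; rewrite inE.
  (* The bottom layer is at most [1], which accounts for the summand [e]; layer [i + 1] vanishes
     outside [A i], where [f / e < i + 1]. *)
  have := clip_sum N.+1 fe0; rewrite big_ord_recl.
  have : (clip 0 (f x / e) <= 1)%R by rewrite ge_min lexx.
  have : (\sum_(i < N) clip (lift ord0 i) (f x / e) <= \sum_(k < N) \1_(A k) x)%R.
    apply: ler_sum => i _; rewrite indicE; have [xA|xA] := boolP (x \in A i).
      by rewrite ge_min lexx.
    rewrite ge_min ge_max lexx/=; apply/orP; right.
    by rewrite subr_le0 ltW// ltNge; apply: contra xA; rewrite inE.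
  rewrite [Num.min _ _]min_l; first lra.
  by rewrite -natr1; lra.
have ms k : measurable_fun [set: borel E] (fun x => (e * \1_(A k) x)%:E).
  by apply/measurable_EFinP/measurable_funM => //; exact: measurable_indic.
have s0 k x : 0 <= (e * \1_(A k) x)%:E by rewrite lee_fin mulr_ge0// ltW.
have mS : measurable_fun [set: borel E] s by exact: emeasurable_sum.
have mI : measurable_fun [set: borel E] (fun x => (\1_B x : R)%:E).
  by apply/measurable_EFinP; exact: measurable_indic.
apply: (@le_trans _ _ (\int[radon_measure]_x (e%:E + s x + +oo * (\1_B x)%:E))).
  apply: ge0_le_integral => //; first by move=> x _; rewrite lee_fin.
  - by apply/measurable_EFinP.
  - apply: emeasurable_funD; last exact: measurable_funeM.
    exact: emeasurable_funD.
have ss0 x : 0 <= s x by exact: sume_ge0.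
rewrite ge0_integralD//; last 3 first.
- by move=> x _; rewrite adde_ge0// lee_fin ltW.
- exact: emeasurable_funD.
- exact: measurable_funeM.
rewrite ge0_integralD//; last by move=> x _; rewrite lee_fin ltW.
rewrite ge0_integralZl//.
rewrite integral_indic// setIT [X in +oo * X]B0 mule0 adde0 integral_cst//.
rewrite [X in e%:E * X]radon_measure_setT mule1 addeC leeD2r// ge0_integral_sum//.
apply: (@le_trans _ _ (\sum_(k < N) (e * L (clip k \o (fun x => f x / e)))%:E)).
  apply: lee_sum => k _; under eq_integral do rewrite EFinM.
  rewrite ge0_integralZl//; last 2 first.
  - by apply/measurable_EFinP; exact: measurable_indic.
  - by rewrite lee_fin ltW.
  by rewrite integral_indic// setIT EFinM lee_wpmul2l// lee_fin ltW.
rewrite sumEFin lee_fin -mulr_sumr.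
rewrite -(@L_sum (fun k => clip k \o (fun x => f x / e)%R)); last first.
  by move=> k; exact: clip_cont.
have cS : continuous (fun x => \sum_(i < N) (clip i \o (fun y => f y / e)) x)%R.
  by apply: (@sum_cont (fun k => clip k \o (fun y => f y / e)%R)) => k; exact: clip_cont.
rewrite -LZ//; apply: L_le => //; first exact: rcontinuousZ.
move=> x _ /=; rewrite clip_sum ?divr_ge0 ?(ltW e0)//.
by rewrite -ler_pdivlMl// mulrC ge_min lexx.
Qed.

(** Countable subadditivity of [radon_outer] bounds every cover of [S] by Borel sets from below by
    [radon_outer S]. *)
Lemma radon_measure_compact : mu_ext radon_measure S = 1.
Proof.
apply/eqP; rewrite eq_le; apply/andP; split.
  by rewrite -radon_measure_setT -measurable_mu_extE//; exact: le_mu_ext.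
apply/ereal_infP => _ [A [mA SA] <-].
apply: le_trans radon_outer_compact _; apply: le_trans (le_radon_outer SA) _.
exact: radon_outer_sigma_subadditive.
Qed.

Lemma positive_functional_measure :
  exists eta : probability (borel E) R, mu_ext eta S = 1 /\
    forall f : E -> R, continuous f -> (forall x, 0 <= f x)%R ->
      \int[eta]_x (f x)%:E <= (L f)%:E.
Proof.
exists radon_measure; split; first exact: radon_measure_compact.
exact: radon_measure_integral_le.
Qed.

End representing_measure.

(** * Distance to a set *)

Section metric_bumps.
Variables (R : realType) (M : metricType R).

Definition dist_set (C : set M) (x : M) : R := inf [set mdist x y | y in C].

Lemma dist_set_ge0 C x : 0 <= dist_set C x.
Proof.
have [->|/set0P[c Cc]] := eqVneq C set0; first by rewrite /dist_set image_set0 inf0.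
apply: lb_le_inf; first by exists (mdist x c), c.
by move=> _ [y _ <-]; exact: mdist_ge0.
Qed.

Lemma dist_set_le C x y : C y -> dist_set C x <= mdist x y.
Proof.
move=> Cy; apply: ge_inf; last by exists y.
by exists 0 => _ [z _ <-]; exact: mdist_ge0.
Qed.

Lemma dist_set_triangle C x y : C !=set0 -> dist_set C x <= mdist x y + dist_set C y.
Proof.
move=> [c Cc]; rewrite -lerBlDl; apply: lb_le_inf; first by exists (mdist y c), c.
move=> _ [z Cz <-]; rewrite lerBlDl (le_trans (dist_set_le x Cz))//.
exact: metric_triangle.
Qed.

Lemma dist_set_continuous C : C !=set0 -> continuous (dist_set C).
Proof.
move=> C0 x; apply/cvgrPdist_lt => e e0.
near=> y; have xy : mdist x y < e.
  near: y; apply: (metricType_numDomainType.cvgr_dist_lt (F := nbhs x) (f := id)) => //.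
have := dist_set_triangle x y C0; have := dist_set_triangle y x C0.
rewrite [mdist y x]metric_sym => H1 H2.
rewrite ltr_norml; apply/andP; split; lra.
Unshelve. all: by end_near. Qed.

Lemma dist_set_gt0 C x : C !=set0 -> closed C -> ~ C x -> 0 < dist_set C x.
Proof.
move=> [c Cc] cC nCx; rewrite lt_neqAle dist_set_ge0 andbT eq_sym.
apply/eqP => d0; apply: nCx; apply: cC => B /nbhs_ballP[e /= e0 Be].
have E0 : has_inf [set mdist x y | y in C].
  split; first by exists (mdist x c), c.
  by exists 0 => _ [z _ <-]; exact: mdist_ge0.
have [_ [y Cy <-]] := inf_adherent e0 E0.
rewrite -/(dist_set C x) d0 add0r => xy; exists y; split => //.
by apply: Be; rewrite ballEmdist.
Qed.

End metric_bumps.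

(** * Continuous approximation of open sets from below *)

Section open_approximation.
Variables (R : realType) (X : topologicalType).

(** The value [1] is reached, not just approached: convergence to the indicator is eventually
    constant, and the closed sets where [h n >= 1] exhaust [U]. *)
Definition open_bumps (U : set X) (h : nat -> X -> R) : Prop :=
  [/\ forall n, continuous (h n), forall n x, 0 <= h n x <= 1,
     forall x, {homo h^~ x : i j / (i <= j)%N >-> i <= j},
     forall n x, ~ U x -> h n x = 0 &
     forall x, U x -> exists n, h n x = 1].

Lemma polish_open_bumps (U : set X) : polish R X -> open U ->
  exists h : nat -> X -> R, open_bumps U h.
Proof.
move=> [_ [M [f [g [fK gK cf cg _]]]]] oU.
(* The distance to the empty set is [0] by convention, so the whole space is treated apart. *)
have [UT|/set0P[c Uc]] := eqVneq (~` U) set0.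
  exists (fun _ _ => 1); split => //.
  - by move=> n; exact: cst_continuous.
  - by move=> *; rewrite lexx ler01.
  - by move=> x i j _; exact: lexx.
  - by move=> n x nUx; have : (~` U) x by []; rewrite UT.
  - by move=> x _; exists 0%N.
pose C := g @^-1` (~` U).
have C0 : C !=set0 by exists (f c); rewrite /C /= fK.
have cC : closed C by apply: preimage_closed => [x _|]; [exact: cg|exact: open_closedC].
pose d x := dist_set C (f x).
have cd : continuous d.
  by move=> x; exact: (continuous_comp (cf x) (dist_set_continuous C0 (x := f x))).
have d0 x : 0 <= d x by exact: dist_set_ge0.
exists (fun n x => Num.min 1 (n%:R * d x)); split.
- move=> n x; apply: (@continuous_min _ _ (fun=> 1) (fun x => n%:R * d x)).
    exact: cst_continuous.
  by apply: continuousM; [exact: cst_continuous|exact: cd].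
- by move=> n x; rewrite le_min ler01 mulr_ge0// ge_min lexx.
- move=> x i j ij; rewrite le_min ge_min lexx/= ge_min; apply/orP; right.
  by rewrite ler_wpM2r// ler_nat.
- move=> n x nUx; have -> : d x = 0.
    apply/eqP; rewrite eq_le d0 andbT -(mdistxx (f x)).
    by apply: dist_set_le; rewrite /C /= fK.
  by rewrite mulr0 min_r.
- move=> x Ux; have dx : 0 < d x.
    by apply: dist_set_gt0 => //; rewrite /C /= fK => /(_ Ux).
  exists (Num.truncn (d x)^-1).+1; rewrite min_l//.
  by rewrite -ler_pdivrMr// mul1r ltW// truncnS_gt.
Qed.

End open_approximation.

(** * Complete regularity of the weak topology *)

Section mplus_topology.
Variables (R : realType) (X : ptopologicalType).

Lemma Mplus_int_continuous (f : X -> R) : Cb f -> continuous (@Mplus_int R X f).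
Proof.
move=> Cf mu.
have [+ _] := @cvg_sup _ _ (fun g : {f : X -> R | Cb f} =>
  Topological.class (initial_topology (@Mplus_int R X (sval g)))) (nbhs mu) mu _.
move=> /(_ (@cvg_id _ (nbhs mu)) (exist _ f Cf)) H.
apply: cvg_trans (@initial_continuous _ _ (@Mplus_int R X f) mu).
exact: cvg_app H.
Qed.

(** The sets outside of which some bump at [mu] vanishes form a filter [G], products of bumps giving
    intersections. Tent functions of [\int f] show that [G] converges to [mu] in each initial
    topology, hence in their supremum. *)
Lemma Mplus_completely_regular (U : set (Mplus R X)) (mu : Mplus R X) :
  open U -> U mu -> exists f : Mplus R X -> R,
  [/\ continuous f, forall nu, 0 <= f nu <= 1, f mu = 1 & forall nu, ~ U nu -> f nu = 0].
Proof.
pose G : set_system (Mplus R X) := fun A => exists f : Mplus R X -> R,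
  [/\ continuous f, forall nu, 0 <= f nu <= 1, f mu = 1 & forall nu, ~ A nu -> f nu = 0].
move=> oU Umu.
have FG : Filter G.
  split.
  - exists (fun=> 1); split => //; first exact: cst_continuous.
      by move=> _; rewrite lexx ler01.
    by move=> nu [].
  - move=> A B [f [cf f01 fmu fA]] [g [cg g01 gmu gB]]; exists (f \* g); split.
    + by move=> nu; exact: continuousM (cf nu) (cg nu).
    + move=> nu /=; have /andP[f0 f1] := f01 nu; have /andP[g0 g1] := g01 nu.
      by rewrite mulr_ge0// mulr_ile1.
    + by rewrite /= fmu gmu mulr1.
    + move=> nu /= /not_andP[/fA ->|/gB ->]; first by rewrite mul0r.
      by rewrite mulr0.
  - move=> A B AB [f [cf f01 fmu fA]]; exists f; split => // nu nB; apply: fA.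
    by move=> /AB.
have GU : G --> mu.
  apply: (@cvg_sup _ _ (fun g : {f : X -> R | Cb f} => Topological.class
    (initial_topology (@Mplus_int R X (sval g)))) G mu FG).2 => -[f Cf] A.
  rewrite nbhsE => -[_ [[V oV <-] Vmu VA]].
  have /nbhs_ballP[e /= e0 eV] : nbhs (Mplus_int f mu) V by apply: open_nbhs_nbhs.
  exists (fun nu => Num.max 0 (1 - `|Mplus_int f nu - Mplus_int f mu| / e)); split.
  - move=> nu; apply: (@continuous_max _ _ (fun=> 0)
      (fun nu => 1 - `|Mplus_int f nu - Mplus_int f mu| / e)).
      exact: cst_continuous.
    apply: continuousB; first exact: cst_continuous.
    apply: continuousM; last exact: cst_continuous.
    apply: (continuous_comp (f := fun nu => Mplus_int f nu - Mplus_int f mu)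
       (g := fun r : R => `|r|)); last exact: norm_continuous.
    by apply: continuousB; [exact: Mplus_int_continuous|exact: cst_continuous].
  - move=> nu; rewrite le_max lexx/= ge_max ler01/= gerBl divr_ge0// ltW//.
  - by rewrite subrr normr0 mul0r subr0 max_r.
  - move=> nu nA; rewrite max_l// subr_le0 ler_pdivlMr// mul1r leNgt.
    apply/negP => H; apply: nA; apply: VA; apply: eV.
    by rewrite /ball/= distrC.
by apply: GU; exact: open_nbhs_nbhs.
Qed.

End mplus_topology.

(** * Separation of measures by [Cb], and measurability in the measure *)

Section mplus_measures.
Variables (R : realType) (X : ptopologicalType).
Hypothesis hX : polish R X.
Local Open Scope ereal_scope.

Lemma Cb_measurable (f : X -> R) : Cb f ->
  measurable_fun [set: borel X] (fun x : borel X => (f x)%:E).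
Proof. by move=> [cf _]; apply/measurable_EFinP; exact: continuous_borel_measurable. Qed.

Lemma Cb_integrable (f : X -> R) (mu : Mplus R X) : Cb f ->
  mu.-integrable [set: borel X] (EFin \o f).
Proof.
move=> [cf bf]; apply: measurable_bounded_integrable => //.
- by rewrite ltey_eq fin_num_measure.
- exact: continuous_borel_measurable.
Qed.

Lemma Mplus_intE (f : X -> R) (mu : Mplus R X) : Cb f ->
  \int[mu]_x (f x)%:E = (Mplus_int f mu)%:E.
Proof.
move=> Cf; rewrite /Mplus_int /Rintegral fineK//.
exact: integrable_fin_num (Cb_integrable mu Cf).
Qed.

Lemma Cb_unit (f : X -> R) : continuous f -> (forall x, (0 <= f x <= 1)%R) -> Cb f.
Proof.
move=> cf f01; split => //; exists 1%R; split => // M M1 x _.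
by have /andP[f0 f1] := f01 x; rewrite /= ger0_norm// (le_trans f1)// ltW.
Qed.

Lemma open_bumps_cvg (U : set X) (h : nat -> X -> R) : open_bumps U h ->
  forall x, (h n x)%:E @[n --> \oo] --> (\1_U x : R)%:E.
Proof.
move=> [_ h01 hnd h0 h1] x; apply: cvg_near_cst; rewrite indicE.
have [/set_mem Ux|] := boolP (x \in U); last first.
  by move/negP => nUx; apply: nearW => n; rewrite h0// => Ux; apply: nUx; exact/mem_set.
have [N hN] := h1 _ Ux; exists N => // n /= Nn; congr EFin; apply/eqP.
by rewrite eq_le; have /andP[_ ->] := h01 n x; rewrite -hN; exact: hnd.
Qed.

Lemma open_bumps_int_cvg (U : set X) (h : nat -> X -> R) (mu : Mplus R X) :
  open U -> open_bumps U h ->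
  (Mplus_int (h n) mu)%:E @[n --> \oo] --> mu U.
Proof.
move=> oU hU; have [ch h01 hnd _ _] := hU.
have Ch n : Cb (h n) by apply: Cb_unit; [exact: ch|exact: h01].
have mU : measurable (U : set (borel X)) by exact: open_borel_measurable.
rewrite -[X in _ --> X](_ : \int[mu]_x limn (fun n => (h n x)%:E) = _); last first.
  rewrite (eq_integral (fun x : borel X => (\1_(U : set (borel X)) x : R)%:E)).
    by rewrite integral_indic// setIT.
  move=> x _.
  by apply/cvg_lim => //; exact: open_bumps_cvg.
under eq_fun do rewrite -Mplus_intE//.
apply: cvg_monotone_convergence => //.
- by move=> n; exact: Cb_measurable.
- by move=> n x _; rewrite lee_fin; have /andP[] := h01 n x.
- by move=> x _ i j ij; rewrite lee_fin; exact: hnd.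
Qed.

Lemma eq_finite_measure d (T : measurableType d)
    (m1 m2 : {finite_measure set T -> \bar R}) :
  (m1 = m2 :> (set T -> \bar R)) -> m1 = m2.
Proof.
case: m1 m2 => [f1 [[a1 b1] [c1] [d1] [e1] [g1]]] [f2 [[a2 b2] [c2] [d2] [e2] [g2]]] /= E.
subst f2.
rewrite (Prop_irrelevance a2 a1) in c2 *; rewrite (Prop_irrelevance b2 b1) in c2 *.
by rewrite (Prop_irrelevance c2 c1) (Prop_irrelevance d2 d1)
  (Prop_irrelevance e2 e1) (Prop_irrelevance g2 g1).
Qed.

Lemma Mplus_ext (mu nu : Mplus R X) :
  (forall A : set (borel X), measurable A -> mu A = nu A) -> mu = nu.
Proof.
move=> H; have {H} : (mu : set (borel X) -> \bar R) = nu.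
  apply/funext => A; have [mA|mA] := pselect (measurable A); first exact: H.
  by rewrite !Mplus_canonical.
move=> /eq_finite_measure; case: mu nu => [mu hmu] [nu hnu] /= E.
by subst nu; congr MkMplus; exact: Prop_irrelevance.
Qed.

(** Bumps recover the measures of open sets, and these form a pi-system generating the Borel
    sets. *)
Lemma Mplus_int_inj (mu nu : Mplus R X) :
  (forall f, Cb f -> Mplus_int f mu = Mplus_int f nu) -> mu = nu.
Proof.
move=> H; apply: Mplus_ext.
apply: (@measure_unique _ _ (borel X) (@open X) (fun=> setT)) => //.
- exact: openI.
- by move=> _; exact: openT.
- by rewrite bigcup_const//; exists 0%N.
- move=> U oU; have [h hU] := polish_open_bumps hX oU.
  have [ch h01 _ _ _] := hU.
  have := @open_bumps_int_cvg U h mu oU hU.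
  under eq_fun do rewrite (H _ (Cb_unit (ch _) (h01 _))).
  have := @open_bumps_int_cvg U h nu oU hU.
  by move=> a b; exact: (cvg_unique (@ereal_hausdorff R) b a).
- by move=> _; rewrite ltey_eq fin_num_measure.
Qed.

Lemma Mplus_hausdorff : hausdorff_space (Mplus R X).
Proof.
move=> mu nu H; apply: Mplus_int_inj => f Cf.
have cf := Mplus_int_continuous Cf.
apply: (@Rhausdorff R) => A B /cf nA /cf nB.
by have [x [Ax Bx]] := H _ _ nA nB; exists (Mplus_int f x).
Qed.

(** For open sets, evaluation is a limit of continuous functionals; complements and disjoint unions
    follow by Dynkin's theorem. *)
Lemma Mplus_eval_measurable (A : set (borel X)) : measurable A ->
  measurable_fun [set: borel (Mplus R X)]
    (fun mu : borel (Mplus R X) => (mu : Mplus R X) A).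
Proof.
have mO (U : set X) : open U ->
    measurable_fun [set: borel (Mplus R X)]
      (fun mu : borel (Mplus R X) => (mu : Mplus R X) U).
  move=> oU; have [h hU] := polish_open_bumps hX oU.
  have [ch h01 _ _ _] := hU.
  apply: (emeasurable_fun_cvg (fun (n : nat) (mu : borel (Mplus R X)) =>
    (Mplus_int (h n) (mu : Mplus R X))%:E)).
    move=> n; apply/measurable_EFinP; apply: continuous_borel_measurable.
    by apply: Mplus_int_continuous; apply: Cb_unit; [exact: ch|exact: h01].
  by move=> mu _; exact: open_bumps_int_cvg.
move: A; apply: (@dynkin_induction _ (borel X) (@open X)) => //.
- exact: openI.
- by apply: mO; exact: openT.
- move=> A mA IH.
  apply: (eq_measurable_fun (fun mu : borel (Mplus R X) =>
      (mu : Mplus R X) setT - (mu : Mplus R X) A)).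
    by move=> mu _; rewrite -setTD measureD ?setTI// ltey_eq fin_num_measure.
  by apply: emeasurable_funB => //; apply: mO; exact: openT.
- move=> F mF tF IH.
  apply: (eq_measurable_fun (fun mu : borel (Mplus R X) =>
      \sum_(0 <= k <oo) (mu : Mplus R X) (F k))).
    by move=> mu _; rewrite measure_semi_bigcup//; exact: bigcup_measurable.
  exact: ge0_emeasurable_sum.
Qed.

Lemma Mplus_integral_measurable (f : borel X -> \bar R) :
  measurable_fun [set: borel X] f -> (forall x, 0 <= f x) ->
  measurable_fun [set: borel (Mplus R X)]
    (fun mu : borel (Mplus R X) => \int[(mu : Mplus R X)]_x f x).
Proof.
move=> mf f0.
apply: (measurable_fun_integral_kernel
  (l := fun mu : borel (Mplus R X) => (mu : Mplus R X))) => //.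
exact: Mplus_eval_measurable.
Qed.

End mplus_measures.

(** * Regularity of finite Borel measures *)

Section closed_regularity.
Variables (R : realType) (X : ptopologicalType).
Hypothesis hX : polish R X.
Variable mu : {measure set (borel X) -> \bar R}.
Hypothesis mufin : forall A : set (borel X), measurable A -> mu A \is a fin_num.
Local Open Scope ereal_scope.

(** Inner and outer approximation are required together, which makes the condition symmetric under
    complements. *)
Definition regular_set (A : set (borel X)) : Prop := forall e : R, (0 < e)%R ->
  exists (F U : set X), [/\ closed F, open U, F `<=` A, A `<=` U &
    mu (U `\` F) <= e%:E].

Let mO (U : set X) : open U -> measurable (U : set (borel X)).
Proof. exact: open_borel_measurable. Qed.
Let mC (F : set X) : closed F -> measurable (F : set (borel X)).
Proof. exact: closed_borel_measurable. Qed.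

Lemma measure_bigcup_tail (F : nat -> set (borel X)) (e : R) :
  (forall n, measurable (F n)) -> (forall n, F n `<=` F n.+1) -> (0 < e)%R ->
  exists n, mu ((\bigcup_n F n) `\` F n) <= e%:E.
Proof.
move=> mF FS e0.
have mU : measurable (\bigcup_n F n) by exact: bigcup_measurable.
have Fmono : {homo F : i j / (i <= j)%N >-> (i <= j)%O}.
  apply: homo_leq => // [? ? ?|i]; first exact: le_trans.
  by apply/subsetPset; exact: FS.
have Uf := mufin mU.
have : mu \o F @ \oo --> (fine (mu (\bigcup_n F n)))%:E.
  by rewrite fineK//; exact: nondecreasing_cvg_mu.
move=> /fine_cvgP[_ /cvgrPdist_le /(_ e e0)[N _ /(_ N (leqnn N))]] /=.
have Ff := mufin (mF N) => H; exists N.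
rewrite measureD// ?setIidr//; last 2 first.
- by move=> x Fx; exists N.
- by rewrite ltey_eq Uf.
by have := le_trans (ler_norm _) H; rewrite -lee_fin EFinB !fineK.
Qed.

Lemma regular_set_open (U : set X) : open U -> regular_set U.
Proof.
move=> oU e e0; have [h [ch h01 hnd h0 h1]] := polish_open_bumps hX oU.
pose F n : set X := h n @^-1` [set r | (1 <= r)%R].
have cF n : closed (F n).
  by apply: preimage_closed => [x _|]; [exact: ch|exact: closed_ge].
have FS n : F n `<=` F n.+1.
  by move=> x /= /le_trans; apply; exact: hnd.
have UE : U = \bigcup_n F n.
  apply/seteqP; split=> [x /h1[n hn]|x [n _ Fx]]; first by exists n; rewrite // /F/= hn.
  by apply: contrapT => /(h0 n) hn; move: Fx; rewrite /F /= hn ler10.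
have [n Hn] := measure_bigcup_tail (fun n => mC (cF n)) FS e0.
by exists (F n), U; split => //; rewrite UE// => x Fx; exists n.
Qed.

Lemma regular_set_bigcup (A : nat -> set (borel X)) :
  (forall n, regular_set (A n)) -> regular_set (\bigcup_n A n).
Proof.
move=> rA e e0; have e2 : (0 < e / 2)%R by rewrite divr_gt0.
have en n : (0 < e / 2 / (2 ^ n.+1)%:R)%R by rewrite divr_gt0// ltr0n expn_gt0.
have /choice[F HF] n := rA n _ (en n).
have /choice[U {}HF] := HF.
have cF n : closed (F n) by have [] := HF n.
have oU n : open (U n) by have [] := HF n.
have FA n : F n `<=` A n by have [] := HF n.
have AU n : A n `<=` U n by have [] := HF n.
have UF n : mu (U n `\` F n) <= (e / 2 / (2 ^ n.+1)%:R)%:E by have [] := HF n.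
(* A countable union of closed sets need not be closed: a finite union is kept, and the lost tail
   costs [e / 2]. *)
pose G n : set X := \big[setU/set0]_(i < n) F i.
have cG n : closed (G n) by exact: closed_bigsetU.
have GS n : G n `<=` G n.+1 by rewrite /G big_ord_recr/= => x Gx; left.
have [N HN] := measure_bigcup_tail (fun n => mC (cG n)) GS e2.
have GE x n : F n x -> (\bigcup_n G n) x.
  by move=> Fx; exists n.+1 => //; rewrite /G big_ord_recr; right.
exists (G N), (\bigcup_n U n); split => //.
- exact: bigcup_open.
- by rewrite /G -bigcup_mkord => x [i _ /FA]; exists i.
- by move=> x [i _ /AU]; exists i.
apply: (@le_trans _ _ (mu ((\bigcup_n (U n `\` F n)) `|` ((\bigcup_n G n) `\` G N)))).
  have mUF : measurable (\bigcup_n (U n `\` F n) : set (borel X)).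
    by apply: bigcup_measurable => n _; apply: measurableD; [exact: mO|exact: mC].
  have mGU : measurable (\bigcup_n G n : set (borel X)).
    by apply: bigcup_measurable => n _; exact: mC.
  apply: le_measure; rewrite ?inE.
  - by apply: measurableD; [by apply: mO; apply: bigcup_open|exact: mC].
  - by apply: measurableU => //; apply: measurableD => //; exact: mC.
  move=> x [[n _ Ux] Gx]; have [Fx|Fx] := pselect (F n x).
    by right; split => //; exact: GE Fx.
  by left; exists n.
apply: (le_trans (measureU2 _ _ _)).
- by apply: bigcup_measurable => n _; apply: measurableD; [exact: mO|exact: mC].
- apply: measurableD; last exact: mC.
  by apply: bigcup_measurable => n _; exact: mC.
have -> : e%:E = (e / 2)%:E + (e / 2)%:E by rewrite -EFinD; congr EFin; lra.
apply: leeD => //.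
have mUF n : measurable (U n `\` F n : set (borel X)).
  by apply: measurableD; [exact: mO|exact: mC].
apply: (@le_trans _ _ (\sum_(0 <= n <oo) mu (U n `\` F n))).
  by apply: measure_sigma_subadditive => //; exact: bigcup_measurable.
apply: le_trans (epsilon_trick0 xpredT (ltW e2)).
by apply: lee_nneseries => // n _; exact: UF.
Qed.

Lemma regular_set_borel (A : set (borel X)) : measurable A -> regular_set A.
Proof.
move: A; apply: smallest_sub; last exact: regular_set_open.
split=> [|A rA|F rF].
- by apply: regular_set_open; exact: open0.
- rewrite setTD => e e0; have [F [U [cF oU FA AU H]]] := rA _ e0.
  exists (~` U), (~` F); split.
  + exact: open_closedC.
  + exact: closed_openC.
  + exact: subsetC.
  + exact: subsetC.
  + by rewrite setDE setCK setIC -setDE.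
- exact: regular_set_bigcup.
Qed.

Lemma closed_inner_regular (A : set (borel X)) (e : R) : measurable A -> (0 < e)%R ->
  exists F : set X, [/\ closed F, F `<=` A & mu A <= mu (F : set (borel X)) + e%:E].
Proof.
move=> mA e0; have [F [U [cF oU FA AU H]]] := regular_set_borel mA e0.
exists F; split => //; rewrite -[A](setDUK FA).
apply: (le_trans (measureU2 _ _ _)); [exact: mC|by apply: measurableD => //; exact: mC|].
rewrite leeD2l// (le_trans _ H)// le_measure// ?inE.
- by apply: measurableD => //; exact: mC.
- by apply: measurableD; [exact: mO|exact: mC].
- exact: setSD.
Qed.

End closed_regularity.

(** * Extension of an [L^p] bound from [Cb] to Borel functions *)

Section dual_bound_extension.
Variables (R : realType) (X : ptopologicalType).
Hypothesis hX : polish R X.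
Variable m : {finite_measure set (borel X) -> \bar R}.
Variable nu : {measure set (borel X) -> \bar R}.
Hypothesis nufin : forall A : set (borel X), measurable A -> nu A \is a fin_num.
Variables (p : R) (C : R).
Hypotheses (p0 : (0 < p)%R) (C0 : (0 <= C)%R).
Local Open Scope ereal_scope.
Hypothesis bound_Cb : forall f : X -> R, Cb f -> (forall x, (0 <= f x)%R) ->
  (\int[nu]_x (f x)%:E) `^ p <= C%:E * \int[m]_x ((f x)%:E `^ p).

(** The absolute values keep the sum nonnegative for every list [s]; they change nothing when [s]
    lists the values of a nonnegative simple function. *)
Definition simple_sum (s : seq R) (A : R -> set (borel X)) (x : borel X) : R :=
  (\sum_(y <- s) `|y| * \1_(A y) x)%R.

Let simple_sum_ge0 s A x : (0 <= simple_sum s A x)%R.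
Proof. by apply: sumr_ge0 => y _; rewrite mulr_ge0. Qed.

Lemma measurable_simple_sum s A : (forall y, measurable (A y)) ->
  measurable_fun [set: borel X] (fun x => (simple_sum s A x)%:E).
Proof.
move=> mA; apply/measurable_EFinP; apply: measurable_sum => y.
by apply: measurable_funM => //; exact: measurable_indic.
Qed.

Lemma integral_simple_sum s A : (forall y, measurable (A y)) ->
  \int[nu]_x (simple_sum s A x)%:E = \sum_(y <- s) `|y|%:E * nu (A y).
Proof.
move=> mA; rewrite /simple_sum; under eq_integral do rewrite -sumEFin.
rewrite ge0_integral_sum//; last first.
  by move=> y; apply/measurable_EFinP; apply: measurable_funM.
apply: eq_bigr => y _; under eq_integral do rewrite EFinM.
rewrite ge0_integralZl//; first by rewrite integral_indic// setIT.
by apply/measurable_EFinP; exact: measurable_indic.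
Qed.

(** Indicators of closed sets are approached from above by [1 - h]. On the side of [nu] comparison
    suffices; on the side of [m] the constant [K ^ p] dominates. *)
Lemma bound_closed s (F : R -> set X) : (forall y, closed (F y)) ->
  (\int[nu]_x (simple_sum s F x)%:E) `^ p <=
  C%:E * \int[m]_x ((simple_sum s F x)%:E `^ p).
Proof.
move=> cF.
have mF y : measurable (F y : set (borel X)) by exact: closed_borel_measurable.
have /choice[h hF] y : exists h : nat -> X -> R, open_bumps (~` F y) h.
  by apply: polish_open_bumps => //; exact: closed_openC.
have ch y n : continuous (h y n) by have [] := hF y.
have h01 y n x : (0 <= h y n x <= 1)%R by have [] := hF y.
pose g n x : R := (\sum_(y <- s) `|y| * (1 - h y n x))%R.
have g0 n x : (0 <= g n x)%R.
  by apply: sumr_ge0 => y _; rewrite mulr_ge0// subr_ge0; have /andP[] := h01 y n x.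
have cg n : continuous (g n).
  apply: rcontinuous_sum => y; apply: rcontinuousZ; apply: rcontinuousB => //.
  exact: cst_continuous.
pose K : R := (\sum_(y <- s) `|y|)%R.
have gK n x : (g n x <= K)%R.
  apply: ler_sum => y _; rewrite ler_piMr// gerBl.
  by have /andP[] := h01 y n x.
have K0 : (0 <= K)%R by apply: sumr_ge0.
have Cg n : Cb (g n).
  split => //; exists K; split; first exact: num_real.
  move=> M KM x _ /=; rewrite ger0_norm//.
  by rewrite (le_trans (gK n x))// ltW.
have geq x : \forall n \near \oo, g n x = simple_sum s F x.
  rewrite /g /simple_sum; elim: (s) => [|y s' IH].
    by apply: nearW => n; rewrite !big_nil.
  have [_ _ hnd h0 h1] := hF y.
  have H : \forall n \near \oo, (1 - h y n x = \1_(F y) x)%R.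
    have [Fx|Fx] := pselect (F y x).
      by apply: nearW => n; rewrite indicE mem_set// h0 ?subr0.
    have [N hN] := h1 x Fx; exists N => // n /= Nn.
    rewrite indicE memNset//; apply/eqP; rewrite subr_eq0 eq_le.
    by have /andP[_ ->] := h01 y n x; rewrite andbT -hN hnd.
  apply: filterS2 IH H => n IHn Hn; by rewrite !big_cons IHn Hn.
have mg n : measurable_fun [set: borel X] (fun x => (g n x)%:E) by exact: Cb_measurable.
have gcvg : \int[m]_x ((g n x)%:E `^ p) @[n --> \oo] -->
    \int[m]_x ((simple_sum s F x)%:E `^ p).
  apply: (@dominated_cvg _ _ _ m _ measurableT _ _ (fun=> (K `^ p)%:E)) => //.
  - by move=> n; exact: measurable_fun_poweR.
  - move=> x _; apply: cvg_near_cst; apply: filterS (geq x) => n -> //.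
  - exact: finite_measure_integrable_cst.
  - move=> n x _; rewrite gee0_abs ?poweR_ge0// -poweR_EFin.
    by rewrite le_poweR2r ?lee_fin// ltW.
have sg n : \int[nu]_x (simple_sum s F x)%:E <= \int[nu]_x (g n x)%:E.
  apply: ge0_le_integral => //.
  - by move=> x _; rewrite lee_fin.
  - exact: measurable_simple_sum.
  - move=> x _; rewrite lee_fin; apply: ler_sum => y _; rewrite ler_wpM2l//.
    have [_ _ _ h0 _] := hF y; rewrite indicE; have [|_] := boolP (x \in _).
      by rewrite inE => Fx; rewrite h0 ?subr0.
    by rewrite subr_ge0; have /andP[] := h01 y n x.
have Ccvg : C%:E * \int[m]_x ((g n x)%:E `^ p) @[n --> \oo] -->
    C%:E * \int[m]_x ((simple_sum s F x)%:E `^ p) by exact: cvgeZl.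
rewrite -(cvg_lim _ Ccvg)//; apply: lime_ge; first by apply/cvg_ex; eexists; exact: Ccvg.
apply: nearW => n; apply: le_trans (bound_Cb (Cg n) (g0 n)).
apply: le_poweR2r => //; first exact: ltW.
by apply: integral_ge0 => x _; rewrite lee_fin.
Qed.

(** Replacing each set by a closed subset can only lower the right-hand side, so the approximation
    is needed for [nu] alone. The bound is in root form so that the error is additive. *)
Lemma bound_simple s (A : R -> set (borel X)) : (forall y, measurable (A y)) ->
  \int[nu]_x (simple_sum s A x)%:E <=
  (C%:E * \int[m]_x ((simple_sum s A x)%:E `^ p)) `^ p^-1.
Proof.
move=> mA; apply/lee_addgt0Pr => e e0.
pose K : R := (\sum_(y <- s) `|y| + 1)%R.
have K0 : (0 < K)%R by rewrite ltr_wpDl// sumr_ge0.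
have eK : (0 < e / K)%R by rewrite divr_gt0.
have /choice[F HF] y := closed_inner_regular hX nufin (mA y) eK.
have cF y : closed (F y) by have [] := HF y.
have FA y : F y `<=` A y by have [] := HF y.
have mF y : measurable (F y : set (borel X)) by exact: closed_borel_measurable.
have FAs x : (simple_sum s F x <= simple_sum s A x)%R.
  apply: ler_sum => y _; rewrite ler_wpM2l// !indicE ler_nat.
  by case: (boolP (x \in F y)) => // /set_mem /FA /mem_set ->.
apply: (@le_trans _ _ (\int[nu]_x (simple_sum s F x)%:E + e%:E)).
  rewrite !integral_simple_sum//.
  apply: (@le_trans _ _ (\sum_(y <- s) (`|y|%:E * nu (F y) + (`|y| * (e / K))%:E))).
    apply: lee_sum => y _; rewrite EFinM -ge0_muleDr//; last by rewrite lee_fin ltW.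
    by apply: lee_wpmul2l; [rewrite lee_fin|have [] := HF y].
  rewrite big_split/= leeD2l// sumEFin lee_fin -mulr_suml mulrCA ler_piMr ?(ltW e0)//.
  by rewrite ler_pdivrMr// mul1r lerDl.
rewrite leeD2r// -poweR_le_root//; last 2 first.
- by apply: integral_ge0 => x _; rewrite lee_fin.
- by rewrite mule_ge0 ?lee_fin ?integral_ge0// => x _; exact: poweR_ge0.
apply: le_trans (bound_closed s cF) _; apply: lee_wpmul2l; first by rewrite lee_fin.
apply: ge0_le_integral => //.
- by move=> x _; exact: poweR_ge0.
- by apply: measurable_fun_poweR; exact: measurable_simple_sum.
- by apply: measurable_fun_poweR; exact: measurable_simple_sum.
- by move=> x _; rewrite le_poweR2r ?lee_fin// ltW.
Qed.

Import HBNNSimple.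

Lemma bound_measurable (f : borel X -> \bar R) :
  measurable_fun [set: borel X] f -> (forall x, 0 <= f x) ->
  (\int[nu]_x f x) `^ p <= C%:E * \int[m]_x (f x `^ p).
Proof.
move=> mf f0.
have If0 : 0 <= \int[m]_x (f x `^ p) by apply: integral_ge0 => x _; exact: poweR_ge0.
rewrite poweR_le_root ?integral_ge0 ?mule_ge0 ?lee_fin//.
pose g := nnsfun_approx measurableT mf.
have gE n x : g n x = simple_sum (finmap.enum_fset (fset_set (range (g n))))
    (fun y => g n @^-1` [set y]) x.
  rewrite fimfunE fsbig_finite//= /simple_sum big_seq [RHS]big_seq.
  apply: eq_bigr => y; rewrite in_fset_set// => /set_mem[z _ <-].
  by rewrite ger0_norm.
have gf n x : (g n x)%:E <= f x.
  rewrite -(cvg_lim _ (cvg_nnsfun_approx measurableT mf (fun x _ => f0 x) (x := x) I))//.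
  apply: lime_ge.
    by apply/cvg_ex; exists (f x); exact: cvg_nnsfun_approx.
  by exists n => // k /= nk; rewrite lee_fin; exact/lefP/nd_nnsfun_approx.
have -> : \int[nu]_x f x = limn (fun n => \int[nu]_x (g n x)%:E).
  rewrite -monotone_convergence//.
  - by apply: eq_integral => x _; apply/esym/cvg_lim => //; exact: cvg_nnsfun_approx.
  - by move=> n; exact/measurable_EFinP.
  - by move=> n x _; rewrite lee_fin.
  - by move=> x _ i j ij; rewrite lee_fin; exact/lefP/nd_nnsfun_approx.
apply: lime_le.
  apply: ereal_nondecreasing_is_cvgn => i j ij.
  apply: ge0_le_integral => //.
  - by move=> x _; rewrite lee_fin.
  - exact/measurable_EFinP.
  - exact/measurable_EFinP.
  - by move=> x _; rewrite lee_fin; exact/lefP/nd_nnsfun_approx.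
apply: nearW => n.
under eq_integral do rewrite gE.
apply: le_trans (bound_simple _ _) _ => //.
apply: le_poweR2r; first by rewrite invr_ge0 ltW.
  by rewrite mule_ge0 ?lee_fin ?integral_ge0// => x _; exact: poweR_ge0.
apply: lee_wpmul2l; first by rewrite lee_fin.
apply: ge0_le_integral => //.
- by move=> x _; exact: poweR_ge0.
- by apply: measurable_fun_poweR; exact: measurable_simple_sum.
- exact: measurable_fun_poweR.
- by move=> x _; rewrite -gE le_poweR2r ?lee_fin// ltW.
Qed.

End dual_bound_extension.

(** * The barycenter of a plan as a measure *)

Section barycenter_measure.
Variables (R : realType) (X : ptopologicalType).
Hypothesis hX : polish R X.
Variable eta : probability (borel (Mplus R X)) R.
Local Open Scope ereal_scope.

Definition barycenter (A : set (borel X)) : \bar R :=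
  \int[eta]_(mu in [set: Mplus R X]) mu A.

Let ev_ge0 A (mu : Mplus R X) : 0 <= mu A.
Proof. exact: measure_ge0. Qed.

Lemma barycenter0 : barycenter set0 = 0.
Proof. by rewrite /barycenter; apply: integral0_eq => mu _; rewrite measure0. Qed.

Lemma barycenter_ge0 A : 0 <= barycenter A.
Proof. exact: integral_ge0. Qed.

Lemma barycenter_semi_sigma_additive : semi_sigma_additive barycenter.
Proof.
move=> F mF tF _; rewrite [X in _ --> X](_ : _ =
    \int[eta]_(mu in [set: Mplus R X]) (\sum_(0 <= k <oo) mu (F k))); last first.
  apply: eq_integral => mu _.
  by apply/esym/cvg_lim => //; exact: measure_sigma_additive.
rewrite [X in X @ _](_ : _ =
    (fun n => \int[eta]_(mu in [set: Mplus R X]) (\sum_(0 <= i < n) mu (F i)))); last first.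
  apply/funext => n; rewrite -ge0_integral_sum//.
  by move=> i; exact: Mplus_eval_measurable.
apply: cvg_monotone_convergence => //.
- by move=> n; apply: emeasurable_sum => i; exact: Mplus_eval_measurable.
- by move=> n mu _; rewrite sume_ge0.
- by move=> mu _ i j ij; exact: ereal_nondecreasing_series.
Qed.

HB.instance Definition _ := isMeasure.Build _ (borel X) R barycenter
  barycenter0 barycenter_ge0 barycenter_semi_sigma_additive.

Import HBNNSimple.

Lemma barycenter_sintegral (h : {nnsfun (borel X) >-> R}) :
  sintegral barycenter h = \int[eta]_(mu in [set: Mplus R X]) sintegral mu h.
Proof.
rewrite sintegralE; under [RHS]eq_integral do rewrite sintegralE.
rewrite ge0_integral_fsum//.
- apply: eq_fsbigr => _ /set_mem[x _ <-]; rewrite ge0_integralZl ?lee_fin//.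
  exact: Mplus_eval_measurable.
- by move=> r; apply: measurable_funeM; exact: Mplus_eval_measurable.
- by move=> r mu _; exact: nnsfun_mulemu_ge0.
Qed.

Lemma barycenter_integral (f : borel X -> \bar R) :
    measurable_fun [set: borel X] f -> (forall x, 0 <= f x) ->
  \int[barycenter]_x f x = \int[eta]_(mu in [set: Mplus R X]) \int[mu]_x f x.
Proof.
move=> mf f0; pose g := nnsfun_approx measurableT mf.
have limE (mu : {measure set (borel X) -> \bar R}) :
    \int[mu]_x f x = limn (fun n => sintegral mu (g n)).
  apply: nd_ge0_integral_lim => // x.
    by move=> i j /(nd_nnsfun_approx measurableT mf)/lefP.
  exact: cvg_nnsfun_approx.
rewrite [RHS](eq_integral (fun mu : borel (Mplus R X) =>
    limn (fun n => sintegral (mu : Mplus R X) (g n)))); last by move=> mu _; exact: limE.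
rewrite monotone_convergence//.
- by rewrite limE; under eq_fun do rewrite barycenter_sintegral.
- move=> n; under eq_fun do rewrite -integralT_nnsfun.
  apply: Mplus_integral_measurable => // [|x]; last by rewrite lee_fin.
  exact/measurable_EFinP.
- by move=> n mu _; exact: sintegral_ge0.
- move=> mu _ i j ij; apply: le_sintegral => x.
  by move/lefP: (nd_nnsfun_approx measurableT mf ij).
Qed.
End barycenter_measure.

(** * The [L^p] norm and the continuous modulus on [Cb] *)

Section continuous_norm.
Variables (R : realType) (X : ptopologicalType) (m : Mplus R X) (p : R).
Hypothesis p1 : 1 < p.
Let p0 : 0 < p. Proof. exact: lt_trans p1. Qed.

Lemma LnormE (f : borel X -> \bar R) : (forall x, 0 <= f x)%E ->
  ('N[m]_p%:E[f] = (\int[m]_x (f x `^ p)) `^ p^-1)%E.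
Proof.
move=> f0; rewrite unlock; congr (_ `^ _)%E.
by apply: eq_integral => x _; rewrite gee0_abs.
Qed.

Definition cnorm (f : X -> R) : R := fine ('N[m]_p%:E[EFin \o (f : borel X -> R)]).

Lemma cnormE (f : X -> R) : Cb f -> (cnorm f)%:E = 'N[m]_p%:E[EFin \o (f : borel X -> R)]%E.
Proof.
move=> Cf; rewrite /cnorm fineK// ge0_fin_numE ?Lnorm_ge0//.
have [cf [K [_ HK]]] := Cf.
rewrite unlock; apply: poweR_lty.
apply: (@le_lt_trans _ _ (\int[m]_(x in [set: borel X]) ((`|K| + 1) `^ p)%:E)%E).
  apply: ge0_le_integral => //.
  - by move=> x _; exact: poweR_ge0.
  - apply: measurable_fun_poweR; apply: measurableT_comp => //.
    exact: Cb_measurable.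
  - move=> x _; rewrite -poweR_EFin; apply: le_poweR2r => //; first exact: ltW.
    rewrite /= lee_fin; apply: HK => //.
    by rewrite (le_lt_trans (ler_norm _))// ltrDl.
by rewrite integral_cst// ltey_eq fin_numM// fin_num_measure.
Qed.

Lemma cnorm_ge0 (f : X -> R) : 0 <= cnorm f.
Proof. by apply: fine_ge0; exact: Lnorm_ge0. Qed.

Lemma cnorm_powR (f : X -> R) : Cb f -> (forall x, 0 <= f x) ->
  (\int[m]_x ((f x)%:E `^ p) = (cnorm f `^ p)%:E)%E.
Proof.
move=> Cf f0; rewrite -poweR_EFin cnormE// LnormE.
  by rewrite -poweRrM mulVf ?gt_eqF// poweRe1// integral_ge0// => x _; exact: poweR_ge0.
by move=> x; rewrite lee_fin.
Qed.

Lemma CbD (f g : X -> R) : Cb f -> Cb g -> Cb (fun x => f x + g x).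
Proof.
move=> [cf bf] [cg bg]; split; first exact: rcontinuousD.
have [M [Mr HM]] := bf; have [N [Nr HN]] := bg.
exists (`|M| + 1 + (`|N| + 1)); split; first exact: num_real.
move=> K KMN x _ /=; apply: le_trans (ler_normD _ _) _.
apply: le_trans (ltW KMN); apply: lerD.
  by apply: HM => //; rewrite (le_lt_trans (ler_norm _))// ltrDl.
by apply: HN => //; rewrite (le_lt_trans (ler_norm _))// ltrDl.
Qed.

Lemma CbZ (t : R) (f : X -> R) : Cb f -> Cb (fun x => t * f x).
Proof.
move=> [cf [M [Mr HM]]]; split; first exact: rcontinuousZ.
exists (`|t| * (`|M| + 1)); split; first exact: num_real.
move=> K KM x _ /=; rewrite normrM; apply: le_trans (ltW KM).
apply: ler_wpM2l => //; apply: HM => //.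
by rewrite (le_lt_trans (ler_norm _))// ltrDl.
Qed.

Lemma Cb_cst (c : R) : Cb (fun _ : X => c).
Proof.
split; first exact: cst_continuous.
by exists `|c|; split; [exact: num_real|move=> K cK x _; exact: ltW].
Qed.

Lemma cnormD (f g : X -> R) : Cb f -> Cb g ->
  cnorm (fun x => f x + g x) <= cnorm f + cnorm g.
Proof.
move=> Cf Cg; rewrite -lee_fin EFinD !cnormE//; last exact: CbD.
apply: eminkowski; [exact: continuous_borel_measurable Cf.1|
  exact: continuous_borel_measurable Cg.1|].
by rewrite lee_fin ltW.
Qed.

Lemma cnormZ (t : R) (f : X -> R) : 0 <= t -> Cb f -> (forall x, 0 <= f x) ->
  cnorm (fun x => t * f x) = t * cnorm f.
Proof.
move=> t0 Cf f0; apply: EFin_inj; rewrite EFinM !cnormE//; last exact: CbZ.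
rewrite !LnormE; try by move=> x; rewrite lee_fin ?mulr_ge0.
rewrite (eq_integral (fun x : borel X => t%:E `^ p * (f x)%:E `^ p)%E); last first.
  by move=> x _; rewrite -poweRM ?lee_fin.
rewrite ge0_integralZl//; last 3 first.
- by apply: measurable_fun_poweR; exact: Cb_measurable.
- by move=> x _; exact: poweR_ge0.
- exact: poweR_ge0.
rewrite poweRM ?poweR_ge0 ?integral_ge0//; last by move=> x _; exact: poweR_ge0.
by rewrite -poweRrM divff ?gt_eqF// poweRe1 ?lee_fin.
Qed.

Lemma Mplus_intD (f g : X -> R) (mu : Mplus R X) : Cb f -> Cb g ->
  Mplus_int (fun x => f x + g x) mu = Mplus_int f mu + Mplus_int g mu.
Proof.
move=> Cf Cg; apply: RintegralD => //; exact: Cb_integrable.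
Qed.

Lemma Mplus_intZ (t : R) (f : X -> R) (mu : Mplus R X) : Cb f ->
  Mplus_int (fun x => t * f x) mu = t * Mplus_int f mu.
Proof.
move=> Cf; apply: RintegralZl => //; exact: Cb_integrable.
Qed.

Lemma Mplus_int_ge0 (f : X -> R) (mu : Mplus R X) : (forall x, 0 <= f x) ->
  0 <= Mplus_int f mu.
Proof. by move=> f0; apply: Rintegral_ge0. Qed.

Lemma Modpc_le (S : set (Mplus R X)) (f : X -> R) : Cb f -> (forall x, 0 <= f x) ->
  (forall mu, S mu -> 1 <= Mplus_int f mu) ->
  (Modpc m p S <= (cnorm f `^ p)%:E)%E.
Proof.
move=> Cf f0 fS; rewrite -cnorm_powR//; apply: ereal_inf_lbound; exists f => //.
by split => // mu /fS; rewrite Mplus_intE// lee_fin.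
Qed.

Lemma Modpc_ge0 (S : set (Mplus R X)) : (0 <= Modpc m p S)%E.
Proof.
by apply/ereal_infP => _ [f _ <-]; apply: integral_ge0 => x _; exact: poweR_ge0.
Qed.

Lemma Modp_le_Modpc (S : set (Mplus R X)) : (Modp m p S <= Modpc m p S)%E.
Proof.
apply: ereal_inf_le_tmp => _ [f [Cf f0 fS] <-]; exists (EFin \o f) => //=; split => //.
split; [exact: Cb_measurable|by move=> x; rewrite lee_fin|].
by rewrite [X in (X < _)%E](cnorm_powR Cf f0) ltry.
Qed.

End continuous_norm.

(** * Construction of a plan carried by a compact set *)

Section optimal_plan_existence.
Variables (R : realType) (X : ptopologicalType) (m : Mplus R X) (p : R).
Hypotheses (hX : polish R X) (p1 : 1 < p).
Variable S : set (Mplus R X).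
Hypotheses (cS : compact S) (S0 : S !=set0).
Let p0 : 0 < p. Proof. exact: lt_trans p1. Qed.

Lemma compact_argmin (phi : Mplus R X -> R) : continuous phi ->
  exists2 mu, S mu & forall nu, S nu -> phi mu <= phi nu.
Proof.
move=> cphi; have [mu /set_mem Smu H] := compact_EVT_min S0 cS (continuous_subspaceT cphi).
by exists mu => // nu Snu; apply: H; exact/mem_set.
Qed.

Lemma compact_argmax (phi : Mplus R X -> R) : continuous phi ->
  exists2 mu, S mu & forall nu, S nu -> phi nu <= phi mu.
Proof.
move=> cphi; have [mu /set_mem Smu H] := compact_EVT_max S0 cS (continuous_subspaceT cphi).
by exists mu => // nu Snu; apply: H; exact/mem_set.
Qed.

Variable l : R.
Hypothesis l0 : 0 <= l.
Hypothesis test_le : forall f : X -> R, Cb f -> (forall x, 0 <= f x) ->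
  exists2 mu, S mu & Mplus_int f mu <= l * cnorm m p f.

Definition dominating (phi : Mplus R X -> R) : set R :=
  [set tf.1 + l * cnorm m p tf.2 | tf in
    [set tf : R * (X -> R) | [/\ Cb tf.2, forall x, 0 <= tf.2 x &
      forall mu, S mu -> phi mu <= Mplus_int tf.2 mu + tf.1]]].

(* A linear functional below this gauge is a normalized positive functional on
   continuous functions of the measure, and is at most [l ||f||_p] at
   [mu |-> \int f dmu]. *)
Definition dual_gauge (phi : Mplus R X -> R) : R := inf (dominating phi).

Lemma cnorm0 : cnorm m p (fun=> 0) = 0.
Proof.
have H := @cnormZ _ _ m p p1 0 (fun=> 0) (lexx 0) (@Cb_cst _ _ 0) (fun=> lexx _).
rewrite -[RHS](mul0r (cnorm m p (fun=> 0))) -H.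
by congr cnorm; apply/funext => x; rewrite mul0r.
Qed.

Lemma Mplus_int0 (mu : Mplus R X) : Mplus_int (fun=> 0) mu = 0.
Proof. by rewrite /Mplus_int /Rintegral integral0. Qed.

(** This is where [test_le] enters: at the measure it provides for [f], the cost [t + l ||f||_p] is
    at least [phi], hence at least the minimum of [phi] on [S]. *)
Lemma dominating_has_inf phi : continuous phi -> has_inf (dominating phi).
Proof.
move=> cphi; split.
  have [mu _ H] := compact_argmax cphi.
  exists (phi mu + l * cnorm m p (fun=> 0)), (phi mu, fun=> 0) => //=; split => //.
    exact: Cb_cst.
  by move=> nu Snu; rewrite Mplus_int0 add0r H.
have [mu Smu H] := compact_argmin cphi.
exists (phi mu) => _ [[t f] /= [Cf f0 fphi] <-].
have [nu Snu Hnu] := test_le Cf f0.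
by have := H _ Snu; have := fphi _ Snu; lra.
Qed.

Lemma dual_gauge_le phi t f : continuous phi -> Cb f -> (forall x, 0 <= f x) ->
  (forall mu, S mu -> phi mu <= Mplus_int f mu + t) ->
  dual_gauge phi <= t + l * cnorm m p f.
Proof.
move=> cphi Cf f0 H; apply: ge_inf; first exact: (dominating_has_inf cphi).2.
by exists (t, f).
Qed.

Lemma dual_gauge_cst phi t : continuous phi -> (forall mu, S mu -> phi mu <= t) ->
  dual_gauge phi <= t.
Proof.
move=> cphi H; have := @dual_gauge_le phi t (fun=> 0) cphi (@Cb_cst _ _ 0) (fun=> lexx _).
rewrite cnorm0 mulr0 addr0; apply => mu Smu.
by rewrite Mplus_int0 add0r H.
Qed.

Lemma dual_gauge_sublinear :
  sublinear_on (V := Mplus R X -> R^o)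
    [set phi | continuous (phi : Mplus R X -> R)] dual_gauge.
Proof.
split=> [phi psi cphi cpsi|t phi t0 cphi].
  have cpp : continuous ((phi : Mplus R X -> R) \+ psi) by exact: rcontinuousD.
  apply/ler_addgt0Pr => e e0; have e2 : 0 < e / 2 by rewrite divr_gt0.
  have [_ [[s f] /= [Cf f0 fphi] <-] Hf] := inf_adherent e2 (dominating_has_inf cphi).
  have [_ [[t g] /= [Cg g0 gpsi] <-] Hg] := inf_adherent e2 (dominating_has_inf cpsi).
  have : dual_gauge (phi \+ psi) <= (s + t) + l * cnorm m p (fun x => f x + g x).
    apply: dual_gauge_le => //; first exact: CbD.
      by move=> x; rewrite addr_ge0.
    move=> mu Smu /=; rewrite Mplus_intD//.
    by have := fphi _ Smu; have := gpsi _ Smu; lra.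
  have := ler_wpM2l l0 (@cnormD _ _ m p p1 f g Cf Cg).
  rewrite -/(dual_gauge phi) in Hf; rewrite -/(dual_gauge psi) in Hg; lra.
have ctp : continuous (fun mu => t * (phi : Mplus R X -> R) mu) by exact: rcontinuousZ.
have [->|tn0] := eqVneq t 0.
  rewrite mul0r; apply: dual_gauge_cst; first by rewrite scale0r; exact: cst_continuous.
  by move=> mu _; rewrite scale0r.
have tp : 0 < t by rewrite lt_def tn0.
rewrite -ler_pdivrMl//; apply: lb_le_inf; first exact: (dominating_has_inf cphi).1.
move=> _ [[s f] /= [Cf f0 fphi] <-]; rewrite ler_pdivrMl//.
have : dual_gauge (fun mu => t * (phi : Mplus R X -> R) mu) <=
    t * s + l * cnorm m p (fun x => t * f x).
  apply: dual_gauge_le => //; first exact: CbZ.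
    by move=> x; rewrite mulr_ge0.
  by move=> mu Smu; rewrite Mplus_intZ// -mulrDr ler_wpM2l// fphi.
rewrite cnormZ//; move=> /le_trans; apply; lra.
Qed.

Lemma optimal_plan_Cb : exists eta : probability (borel (Mplus R X)) R,
  mu_ext eta S = 1%E /\
  forall f : X -> R, Cb f -> (forall x, 0 <= f x) ->
    (\int[eta]_(mu in [set: Mplus R X]) \int[mu]_x (f x)%:E <= (l * cnorm m p f)%:E)%E.
Proof.
have [L [LD LZ LS]] : exists L : (Mplus R X -> R) -> R,
  [/\ forall phi psi : Mplus R X -> R, continuous phi -> continuous psi ->
       L (phi \+ psi) = L phi + L psi,
     forall (t : R) (phi : Mplus R X -> R), continuous phi ->
       L (fun mu => t * phi mu) = t * L phi &
     forall phi : Mplus R X -> R, continuous phi -> L phi <= dual_gauge phi].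
  apply: (@hahn_banach R (Mplus R X -> R^o) [set phi | continuous (phi : Mplus R X -> R)]).
  - by move=> phi psi cphi cpsi; exact: (rcontinuousD cphi cpsi).
  - by move=> t phi cphi; exact: (@rcontinuousZ _ _ t _ cphi).
  - exact: dual_gauge_sublinear.
have L_le0 (phi : Mplus R X -> R) : continuous phi ->
    (forall mu, S mu -> phi mu <= 0) -> L phi <= 0.
  by move=> cphi H; apply: le_trans (LS _ cphi) _; exact: dual_gauge_cst.
have c1 (c : R) : continuous (fun _ : Mplus R X => c) by exact: cst_continuous.
have L1 : L (fun=> 1) = 1.
  apply/eqP; rewrite eq_le; apply/andP; split.
    by apply: le_trans (LS _ (c1 1)) _; exact: dual_gauge_cst.
  (* The gauge of the constant [-1] is at most [-1], which by linearity is the lower bound on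
     [L 1]. *)
  have : L (fun=> -1 * 1) <= -1.
    apply: le_trans (LS _ (c1 _)) _; apply: dual_gauge_cst => // mu _.
    by rewrite mulr1.
  by rewrite LZ//; lra.
have [eta [etaS Heta]] := positive_functional_measure LD LZ L_le0 L1
  (@Mplus_completely_regular R X) cS.
exists eta; split => // f Cf f0.
rewrite (eq_integral (fun mu : borel (Mplus R X) =>
  (Mplus_int f (mu : Mplus R X))%:E)); last first.
  by move=> mu _; rewrite Mplus_intE.
have cf := Mplus_int_continuous Cf.
apply: le_trans (Heta _ cf _) _; first by move=> mu; exact: Mplus_int_ge0.
rewrite lee_fin; apply: le_trans (LS _ cf) _.
have := @dual_gauge_le (Mplus_int f) 0 f cf Cf f0; rewrite add0r; apply.
by move=> mu _; rewrite addr0.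
Qed.

Lemma optimal_plan : exists eta : probability (borel (Mplus R X)) R,
  mu_ext eta S = 1%E /\ barycenter_bound m p eta l.
Proof.
have [eta [etaS Heta]] := optimal_plan_Cb; exists eta; split => //.
split => // f [mf f0 fy].
(* Testing with the constant [1] shows that the barycenter has finite mass, as regularity
   demands. *)
have bfin (A : set (borel X)) : measurable A -> barycenter eta A \is a fin_num.
  move=> mA; rewrite ge0_fin_numE ?barycenter_ge0//.
  apply: (@le_lt_trans _ _ (barycenter eta setT)).
    have := @le_measure _ _ _ (barycenter eta) A setT; rewrite !inE; exact.
  have := Heta _ (@Cb_cst _ _ 1) (fun=> ler01); move=> /le_lt_trans.
  move=> /(_ +oo%E (ltry _)); congr (_ < _)%E.
  by apply: eq_integral => mu _; rewrite integral_cst// mul1e.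
rewrite -barycenter_integral//.
have H := @bound_measurable R X hX m (barycenter eta) bfin p (l `^ p) p0 (powR_ge0 _ _).
have fp0 : (0 <= \int[m]_x (f x `^ p))%E by apply: integral_ge0 => x _; exact: poweR_ge0.
rewrite LnormE//.
have -> : (l%:E * (\int[m]_x f x `^ p) `^ p^-1 =
    ((l `^ p)%:E * \int[m]_x f x `^ p) `^ p^-1)%E.
  by rewrite poweRM ?lee_fin ?powR_ge0// poweR_EFin -powRrM divff ?gt_eqF// powRr1.
rewrite -poweR_le_root ?integral_ge0 ?mule_ge0 ?lee_fin ?powR_ge0//.
apply: H => // g Cg g0; rewrite cnorm_powR// -EFinM -powRM ?cnorm_ge0// -poweR_EFin.
apply: le_poweR2r; [exact: ltW|by apply: integral_ge0 => x _; rewrite lee_fin|].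
rewrite barycenter_integral//; first exact: Heta.
exact: Cb_measurable.
Qed.

End optimal_plan_existence.

(** * Comparison of content and modulus *)

Section duality.
Variables (R : realType) (X : ptopologicalType) (m : Mplus R X) (p : R).
Hypotheses (hX : polish R X) (p1 : 1 < p).
Let p0 : 0 < p. Proof. exact: lt_trans p1. Qed.

Lemma Mplus_int1E (mu : Mplus R X) : ((Mplus_int (fun=> 1) mu)%:E = mu setT)%E.
Proof.
rewrite -Mplus_intE; last exact: Cb_cst.
by rewrite integral_cst// mul1e.
Qed.

Lemma Mplus_mass_gt0 (mu : Mplus R X) : mu <> Mplus0 R X -> 0 < Mplus_int (fun=> 1) mu.
Proof.
move=> mu0; rewrite lt_neqAle Mplus_int_ge0 ?andbT//.
apply/eqP => H; apply: mu0; apply: Mplus_ext => A mA.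
apply/eqP; rewrite eq_le measure_ge0 andbT.
have muT : mu setT = 0%E by rewrite -Mplus_int1E -H.
rewrite [leRHS](_ : _ = mu setT); last by rewrite muT.
by apply: le_measure; rewrite ?inE.
Qed.

Lemma Cp_ge0 (S : set (Mplus R X)) : (0 <= Cp m p S)%E.
Proof.
by rewrite /Cp; case: ifP => // _; apply: ereal_sup_ubound; left.
Qed.

Lemma Modp_Mplus0 (S : set (Mplus R X)) : S (Mplus0 R X) -> Modp m p S = +oo%E.
Proof.
move=> S0; rewrite /Modp (_ : [set f | _] = set0) ?image_set0 ?ereal_inf0//.
apply/seteqP; split => // f [_ /(_ _ S0)] /=.
by rewrite integral_measure_zero lee_fin ler10.
Qed.

(** Markov's inequality is applied to the Borel set where [\int f dmu >= 1]. It contains [S], so the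
    outer measure of an arbitrary [S] is controlled. *)
Lemma plan_markov (eta : probability (borel (Mplus R X)) R) (S : set (Mplus R X))
    (f : borel X -> \bar R) :
  measurable_fun [set: borel X] f -> (forall x, (0 <= f x)%E) ->
  (forall mu, S mu -> (1 <= \int[mu]_x f x)%E) ->
  (mu_ext eta S <= \int[eta]_(mu in [set: Mplus R X]) \int[mu]_x f x)%E.
Proof.
move=> mf f0 fS; have mg := Mplus_integral_measurable hX mf f0.
pose A : set (borel (Mplus R X)) := [set mu : Mplus R X | (1 <= \int[mu]_x f x)%E].
have mA : measurable A.
  have := mg measurableT _ (emeasurable_itv `[1%E, +oo[).
  rewrite setTI; congr measurable; apply/seteqP; split => mu /=;
    by rewrite in_itv/= andbT.
apply: (@le_trans _ _ (mu_ext eta A)); first exact: le_mu_ext.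
rewrite measurable_mu_extE//.
rewrite -[leLHS](_ : \int[eta]_(mu in [set: Mplus R X]) (\1_A mu)%:E = _)%E; last first.
  by rewrite integral_indic// setIT.
apply: ge0_le_integral => //.
- by apply/measurable_EFinP; exact: measurable_indic.
- move=> mu _; rewrite indicE; have [/set_mem//|_] := boolP (mu \in A).
  exact: integral_ge0.
Qed.

Lemma plan_bound (eta : probability (borel (Mplus R X)) R) (S : set (Mplus R X))
    (f : borel X -> \bar R) (c : R) : barycenter_bound m p eta c ->
  Lplus m p f -> (forall mu, S mu -> (1 <= \int[mu]_x f x)%E) ->
  (mu_ext eta S <= c%:E * (\int[m]_x (f x `^ p)) `^ p^-1)%E.
Proof.
move=> [c0 Hc] Lf fS; have [mf f0 _] := Lf; rewrite -LnormE//.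
by apply: le_trans (Hc _ Lf); exact: plan_markov.
Qed.

Lemma mu_ext_fin_num (eta : probability (borel (Mplus R X)) R) (S : set (Mplus R X)) :
  mu_ext eta S \is a fin_num.
Proof.
rewrite ge0_fin_numE ?mu_ext_ge0//; apply: (@le_lt_trans _ _ 1%E); last exact: ltry.
rewrite -(@probability_setT _ _ _ eta) -measurable_mu_extE//.
exact: le_mu_ext.
Qed.

Lemma Cp_le_Modp (S : set (Mplus R X)) : (Cp m p S <= Modp m p S `^ p^-1)%E.
Proof.
rewrite /Cp; case: ifPn => [/asboolP S0|_].
  by rewrite Modp_Mplus0// poweRyr// invr_neq0// gt_eqF.
apply/ereal_supP => _ [->|[eta [[c0 Hc0] cq0] <-]]; first exact: poweR_ge0.
have etaS := mu_ext_fin_num eta S.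
have a0 : (0 <= mu_ext eta S)%E by exact: mu_ext_ge0.
have ci0 : 0 <= (cq m p eta)^-1 by rewrite invr_ge0 ltW.
rewrite -poweR_le_root ?mule_ge0 ?lee_fin ?Modp_ge0//.
apply/ereal_infP => _ [f [Lf fS] <-]; have [mf f0 fy] := Lf.
have I0 : (0 <= \int[m]_x (f x `^ p))%E by apply: integral_ge0 => x _; exact: poweR_ge0.
rewrite poweR_le_root ?mule_ge0 ?lee_fin//.
have Hc c : barycenter_bound m p eta c ->
    (mu_ext eta S <= c%:E * (\int[m]_x (f x `^ p)) `^ p^-1)%E.
  by move=> bc; exact: plan_bound.
have Nfin : ((\int[m]_x (f x `^ p)) `^ p^-1)%E \is a fin_num.
  by apply: fin_num_poweR; rewrite ge0_fin_numE.
have N0 : (0 <= (\int[m]_x (f x `^ p)) `^ p^-1)%E by exact: poweR_ge0.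
move: (mu_ext eta S) etaS a0 Hc; case=> // a _ a0.
move: ((\int[m]_x (f x `^ p)) `^ p^-1)%E Nfin N0; case=> // n _; rewrite !lee_fin in a0 *.
move=> n0 Hc; rewrite ler_pdivrMr//.
have Hc' c : barycenter_bound m p eta c -> a <= c * n by move=> /Hc; rewrite lee_fin.
(* If the norm vanishes, the bound already makes [S] null. Otherwise [a / n] is below every
   admissible [c], hence below their infimum [cq]. *)
have [n0'|n0'] := eqVneq n 0.
  by have := Hc' _ Hc0; rewrite n0' mulr0 mul0r.
have np : 0 < n by rewrite lt_def n0'.
rewrite mulrC -ler_pdivrMr//; apply: lb_le_inf; first by exists c0.
by move=> c bc; rewrite ler_pdivrMr// Hc'.
Qed.

(* By definition of the modulus, every [f >= 0] in [Cb] satisfies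
   [\int f dmu <= (Modpc S)^(-1/p) ||f||_p] for some [mu] in [S], which is the
   hypothesis under which [optimal_plan] provides a plan carried by [S]. *)
Lemma Modpc_le_Cp (S : set (Mplus R X)) : compact S -> S !=set0 ->
  ~ S (Mplus0 R X) -> (Modpc m p S `^ p^-1 <= Cp m p S)%E.
Proof.
move=> cS S0 nS.
(* The total mass has a positive minimum [d] on [S]; the constant [d^-1] is then admissible and the
   modulus is finite. *)
have [mu1 Smu1 min1] := compact_argmin cS S0 (Mplus_int_continuous (@Cb_cst R X 1)).
set d := Mplus_int _ _ in min1.
have d0 : 0 < d by apply: Mplus_mass_gt0 => H; apply: nS; rewrite -H.
have Mfin : Modpc m p S \is a fin_num.
  rewrite ge0_fin_numE ?Modpc_ge0//.
  apply: le_lt_trans (ltry (cnorm m p (fun=> d^-1) `^ p)).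
  apply: Modpc_le => //; first exact: Cb_cst.
    by move=> x; rewrite invr_ge0 ltW.
  move=> mu Smu; have := @Mplus_intZ R X d^-1 (fun=> 1) mu (@Cb_cst R X 1).
  rewrite mulr1 => ->; rewrite -[leLHS](mulVf (negbT (gt_eqF d0))).
  by rewrite ler_pM2l ?invr_gt0// min1.
have [M0|M0] := eqVneq (Modpc m p S) 0%E.
  by rewrite M0 poweR0r ?invr_neq0 ?gt_eqF// Cp_ge0.
pose M := fine (Modpc m p S).
have ME : Modpc m p S = M%:E by rewrite fineK.
have Mp : 0 < M.
  by rewrite lt_neqAle fine_ge0 ?Modpc_ge0// andbT eq_sym -eqe -ME.
pose r := M `^ p^-1.
have r0 : 0 < r by exact: powR_gt0.
have rM : r `^ p = M by rewrite -powRrM mulVf ?gt_eqF// powRr1// ltW.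
have l0 : 0 <= r^-1 by rewrite invr_ge0 ltW.
have test (f : X -> R) : Cb f -> (forall x, 0 <= f x) ->
    exists2 mu, S mu & Mplus_int f mu <= r^-1 * cnorm m p f.
  move=> Cf f0; have [mu Smu Hmu] := compact_argmin cS S0 (Mplus_int_continuous Cf).
  exists mu => //; set s := Mplus_int f mu in Hmu *.
  have [s0|s0] := leP s 0; first by apply: le_trans s0 _; rewrite mulr_ge0// cnorm_ge0.
  have : (Modpc m p S <= (cnorm m p (fun x => s^-1 * f x)%R `^ p)%:E)%E.
    apply: Modpc_le => //; first exact: CbZ.
      by move=> x; rewrite mulr_ge0// invr_ge0 ltW.
    move=> nu Snu; rewrite Mplus_intZ// mulrC ler_pdivlMr// mul1r.
    exact: Hmu.
  rewrite ME lee_fin cnormZ ?invr_ge0 ?(ltW s0)// -rM => H.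
  have : r <= s^-1 * cnorm m p f.
    rewrite leNgt; apply/negP => H'; move: H; apply/negP; rewrite -ltNge.
    apply: gt0_ltr_powR; rewrite ?nnegrE ?(ltW r0)//.
    by rewrite mulr_ge0 ?invr_ge0 ?(ltW s0) ?cnorm_ge0.
  by rewrite ler_pdivlMl// ler_pdivlMl// mulrC.
have [eta [etaS Heta]] := optimal_plan hX p1 cS S0 l0 test.
have Cd : Cb (fun _ : X => d^-1) by exact: Cb_cst.
pose n := cnorm m p (fun=> d^-1).
have n0 : 0 <= n by exact: cnorm_ge0.
(* The test function [d^-1] keeps every bound above [n^-1], so that [cq m p eta > 0] and the plan
   counts in [Cp]. *)
have Hc c : barycenter_bound m p eta c -> 1 <= c * n.
  move=> bc; have := @plan_bound eta S (EFin \o (fun=> d^-1)) c bc.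
  have I : (\int[m]_x (((fun=> d^-1) x)%:E `^ p) = (n `^ p)%:E)%E.
    by apply: cnorm_powR => // x; rewrite invr_ge0 ltW.
  rewrite etaS [X in (X `^ _)%E]I poweR_EFin -powRrM divff ?gt_eqF// powRr1//.
  rewrite -EFinM lee_fin.
  apply.
    split; [exact: Cb_measurable|by move=> x; rewrite lee_fin invr_ge0 ltW|].
    by rewrite [X in (X < _)%E]I ltry.
  move=> mu Smu; rewrite [leRHS](_ : _ = (d^-1 * Mplus_int (fun=> 1) mu)%:E); last first.
    by rewrite -(Mplus_intZ _ _ (@Cb_cst R X 1)) mulr1 Mplus_intE.
  by rewrite lee_fin ler_pdivlMl// mulr1 min1.
have np : 0 < n.
  rewrite lt_neqAle n0 andbT eq_sym; apply/eqP => n0'.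
  by have := Hc _ Heta; rewrite n0' mulr0 ler10.
have cqn : n^-1 <= cq m p eta.
  apply: lb_le_inf; first by exists r^-1.
  by move=> c /Hc; rewrite -[_ <= c](ler_pM2r np) mulVf ?gt_eqF.
have cq0 : 0 < cq m p eta by apply: lt_le_trans cqn; rewrite invr_gt0.
have cqr : cq m p eta <= r^-1.
  by apply: ge_inf => //; exists 0 => c [].
rewrite /Cp asboolF// ME poweR_EFin -/r.
apply: le_ereal_sup_tmp; exists (mu_ext eta S * (cq m p eta)^-1%:E)%E.
  by right; exists eta => //; split => //; exists r^-1.
by rewrite etaS mul1e lee_fin -[leLHS]invrK lef_pV2 ?posrE ?invr_gt0.
Qed.

End duality.

(** * The modulus of compact sets *)

Section compact_modulus.
Variables (R : realType) (X : ptopologicalType) (m : Mplus R X) (p : R).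
Hypotheses (hX : polish R X) (p1 : 1 < p).
Let p0 : 0 < p. Proof. exact: lt_trans p1. Qed.

Let poweR_rootK (x : \bar R) : (0 <= x)%E -> ((x `^ p^-1) `^ p = x)%E.
Proof. by move=> x0; rewrite -poweRrM mulVf ?gt_eqF// poweRe1. Qed.

(** The sandwich through [Cp] concerns nonempty sets without the null measure. For the empty set
    [f = 0] is admissible; with the null measure [Modp] is infinite. *)
Lemma Modp_compact (S : set (Mplus R X)) : compact S -> Modp m p S = Modpc m p S.
Proof.
move=> cS; apply/eqP; rewrite eq_le Modp_le_Modpc//=.
have [S0|/set0P S0] := eqVneq S set0.
  apply: le_trans (_ : 0 <= _)%E; last exact: Modp_ge0.
  have := @Modpc_le R X m p p1 S (fun=> 0) (@Cb_cst _ _ 0) (fun=> lexx _).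
  by rewrite cnorm0// powR0 ?gt_eqF// S0; apply.
have [SM|SM] := pselect (S (Mplus0 R X)); first by rewrite Modp_Mplus0// leey.
rewrite -[leLHS]poweR_rootK ?Modpc_ge0// -[leRHS]poweR_rootK ?Modp_ge0//.
apply: le_poweR2r; rewrite ?(ltW p0) ?poweR_ge0//.
by apply: (@le_trans _ _ (Cp m p S)); [exact: Modpc_le_Cp|exact: Cp_le_Modp].
Qed.

(* If [f] is nearly optimal for the continuous modulus of [S], then [f / t] with
   [t < 1] is admissible for the open set [\int f dmu > t]. *)
Lemma Modp_compact_open (S : set (Mplus R X)) (a : \bar R) :
  compact S -> (Modp m p S < a)%E ->
  exists U, [/\ open U, S `<=` U & (Modp m p U < a)%E].
Proof.
move=> cS; rewrite Modp_compact// => /ereal_inf_lt[_ [f [Cf f0 fS] <-]].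
rewrite (@cnorm_powR R X m p p1 f Cf f0); set I := cnorm m p f `^ p => Ia.
have I0 : 0 <= I by exact: powR_ge0.
have [b Ib ba] : exists2 b : R, I < b & (b%:E <= a)%E.
  case: a Ia => [b||]//; first by rewrite lte_fin => Ib; exists b.
  by move=> _; exists (I + 1); rewrite ?ltrDl// leey.
have b0 : 0 < b by exact: le_lt_trans Ib.
(* Any [s] strictly between [I / b] and [1] gives [I / t ^ p = I / s < b]; the midpoint is positive
   even for [I = 0]. *)
pose s := (I / b + 1) / 2.
have Ib1 : I / b < 1 by rewrite ltr_pdivrMr// mul1r.
have Ib0 : 0 <= I / b by rewrite divr_ge0// ltW.
have s0 : 0 < s by rewrite /s; lra.
have s1 : s < 1 by rewrite /s; lra.
pose t := s `^ p^-1.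
have t0 : 0 < t by exact: powR_gt0.
have tp : t `^ p = s by rewrite -powRrM mulVf ?gt_eqF// powRr1// ltW.
have t1 : t < 1.
  rewrite -[ltRHS](congr1 (@^~ p^-1) (@powR1 R)).
  by apply: gt0_ltr_powR; rewrite ?nnegrE ?invr_gt0// ltW.
exists [set mu | t < Mplus_int f mu]; split.
- apply: (@open_comp _ _ (@Mplus_int R X f) [set r | t < r]); last exact: open_gt.
  by move=> mu _; exact: Mplus_int_continuous.
- move=> mu /fS; rewrite Mplus_intE// lee_fin => /(lt_le_trans t1); exact.
apply: lt_le_trans ba.
apply: (@le_lt_trans _ _ (cnorm m p (fun x => t^-1 * f x) `^ p)%:E).
  apply: le_trans (Modp_le_Modpc _ _ _) _ => //.
  apply: Modpc_le => //; first exact: CbZ.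
    by move=> x; rewrite mulr_ge0// invr_ge0 ltW.
  by move=> mu /ltW H; rewrite Mplus_intZ// ler_pdivlMl// mulr1.
rewrite lte_fin cnormZ ?invr_ge0 ?(ltW t0)// powRM ?cnorm_ge0 ?invr_ge0 ?(ltW t0)//.
rewrite -/I -powR_inv1 ?(ltW t0)// -powRrM mulN1r powRN tp ltr_pdivrMl//.
rewrite mulrC -ltr_pdivrMl// mulrC /s; lra.
Qed.

Lemma Modp_bigcap_compact (K : nat -> set (Mplus R X)) :
  (forall n, compact (K n)) -> (forall n, K n.+1 `<=` K n) ->
  Modp m p (K n) @[n --> \oo] --> Modp m p (\bigcap_n K n).
Proof.
move=> cK KS.
have clK n : closed (K n) by apply: compact_closed => //; exact: Mplus_hausdorff.
have Kmono i j : (i <= j)%N -> K j `<=` K i.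
  elim: j => [|j IH]; first by rewrite leqn0 => /eqP ->.
  by rewrite leq_eqVlt => /predU1P[->//|/IH H]; exact: subset_trans (KS j) H.
have cKI : compact (\bigcap_n K n).
  apply: (subclosed_compact _ (cK 0%N)); first by apply: closed_bigI.
  by move=> mu; apply.
have ni : {homo (fun n => Modp m p (K n)) : i j / (i <= j)%N >-> (j <= i)%E}.
  by move=> i j ij; apply/le_Modp/Kmono.
suff <- : ereal_inf (range (fun n => Modp m p (K n))) = Modp m p (\bigcap_n K n).
  exact: ereal_nonincreasing_cvgn.
apply/eqP; rewrite eq_le; apply/andP; split; last first.
  by apply/ereal_infP => _ [n _ <-]; apply: le_Modp => mu; apply.
rewrite leNgt; apply/negP => /(Modp_compact_open cKI)[U [oU KU]].
apply/negP; rewrite -leNgt.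
suff [n KnU] : exists n, K n `<=` U.
  by apply: le_trans (le_Modp m p KnU); apply: ereal_inf_lbound; exists n.
apply: contrapT => nKU.
(* If no [K n] lies in [U], these sets cluster at a point of the intersection outside [U]. *)
pose F := filter_from [set: nat] (fun n => K n `\` U).
have PF : ProperFilter F.
  apply: filter_from_proper.
    apply: filter_from_filter; first by exists 0%N.
    move=> i j _ _; exists (maxn i j) => // mu [Kmu Umu].
    by split; split => //; apply: Kmono Kmu; rewrite ?leq_maxl ?leq_maxr.
  move=> n _; apply/set0P/eqP => KU0; apply: nKU; exists n.
  by move=> mu Kmu; apply: contrapT => nU; have : set0 mu by rewrite -KU0.
have FK : F (K 0%N) by exists 0%N => // mu [].
have [mu [Kmu Fmu]] := cK 0%N F PF FK.
have H n : (K n `&` ~` U) mu.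
  have : closed (K n `&` ~` U) by apply: closedI => //; exact: open_closedC.
  apply; move=> B nB; have [|nu [Hnu Bnu]] := Fmu (K n `\` U) B _ nB.
    by exists n.
  by exists nu.
have [_ nU] := H 0%N; apply: nU; apply: KU => n _.
by have [] := H n.
Qed.

End compact_modulus.

(** * Decreasing sets with small finite covers in a complete space *)

Section souslin_capacitability.
Variables (R : realType) (M : metricType R).
Hypothesis complete : forall F : set_system M, ProperFilter F -> cauchy F ->
  exists l : M, F --> l.

Lemma ultra_bigcup (F : set_system M) (C : nat -> set M) n : UltraFilter F ->
  F (\bigcup_(i < n) C i) -> exists i, F (C i).
Proof.
move=> FU; elim: n => [|n IH].
  rewrite bigcup_mkord big_ord0 => F0.
  by case: (@filter_not_empty _ F _).
rewrite bigcup_mkord big_ord_recr/= -bigcup_mkord => FUn.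
have [/IH//|FC] := in_ultra_setVsetC (\bigcup_(i < n) C i) FU.
exists n; apply: filterS (filterI FC FUn) => x [nC []//].
Qed.

(* Compactness of the intersection is total boundedness plus completeness.  The
   sets [D n] themselves are not compact, but an ultrafilter containing all of
   them still converges, so that an open set containing the intersection
   contains some [D n]. *)
Variables (C : nat -> nat -> set M) (D : nat -> set M).
Hypothesis cD : forall n, closed (D n).
Hypothesis smallC : forall n i x y, C n i x -> C n i y -> mdist x y < 2 / n.+1%:R.
Hypothesis decD : forall n, D n.+1 `<=` D n.
Hypothesis coverD : forall n, exists k, D n.+1 `<=` \bigcup_(i < k) C n i.

(** By [coverD] the ultrafilter contains, for every [n], one of the small sets [C n i], and is
    therefore Cauchy. *)
Lemma ultra_cvg_bigcap (F : set_system M) : UltraFilter F -> (forall n, F (D n)) ->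
  exists2 l, (\bigcap_n D n) l & F --> l.
Proof.
move=> FU FD.
have [l Fl] : exists l : M, F --> l.
  apply: complete; apply: cauchy_exP => e e0.
  pose n := Num.truncn (2 / e).
  have ne : 2 / n.+1%:R < e.
    by rewrite ltr_pdivrMr// mulrC -ltr_pdivrMr// truncnS_gt.
  have [k Dk] := coverD n.
  have [i FC] := ultra_bigcup FU (filterS Dk (FD n.+1)).
  have [x Cx] := @filter_ex _ F _ _ FC.
  exists x; apply: filterS FC => y Cy; rewrite ballEmdist /=.
  exact: lt_trans (smallC Cx Cy) ne.
exists l => // n _; apply: cD => B /Fl FB.
exact: (@filter_ex _ F _ _ (filterI (FD n) FB)).
Qed.

Lemma compact_bigcap_cover : compact (\bigcap_n D n).
Proof.
rewrite compact_ultra => F FU FD.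
have [|l Dl Fl] := ultra_cvg_bigcap FU; last by exists l.
by move=> n; apply: filterS FD => x; apply.
Qed.

Lemma bigcap_cover_open (U : set M) : open U -> \bigcap_n D n `<=` U ->
  exists n, D n `<=` U.
Proof.
move=> oU DU; apply: contrapT => nDU.
have Dmono i j : (i <= j)%N -> D j `<=` D i.
  elim: j => [|j IH]; first by rewrite leqn0 => /eqP ->.
  by rewrite leq_eqVlt => /predU1P[->//|/IH H] x /decD /H.
pose F := filter_from [set: nat] (fun n => D n `\` U).
have PF : ProperFilter F.
  apply: filter_from_proper.
    apply: filter_from_filter; first by exists 0%N.
    move=> i j _ _; exists (maxn i j) => // x [Dx Ux].
    by split; split => //; apply: Dmono Dx; rewrite ?leq_maxl ?leq_maxr.
  move=> n _; apply/set0P/eqP => DU0; apply: nDU; exists n.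
  by move=> x Dx; apply: contrapT => nU; have : set0 x by rewrite -DU0.
have [G [GU FG]] := ultraFilterLemma PF.
have GD n : G (D n `\` U) by apply: FG; exists n.
have [|l Dl Gl] := ultra_cvg_bigcap GU.
  by move=> n; apply: filterS (GD n) => x [].
have GlU : G U by apply: Gl; apply: open_nbhs_nbhs; split => //; exact: DU.
by have [x [[_ nU] Ux]] := @filter_ex _ G _ _ (filterI (GD 0%N) GlU).
Qed.

End souslin_capacitability.

(** * Capacitability of Souslin sets *)

Section choquet_souslin.
Variables (R : realType) (E : topologicalType) (I : set E -> \bar R).
Local Open Scope ereal_scope.
Hypothesis I_ge0 : forall A, 0 <= I A.
Hypothesis I_le : forall A B, A `<=` B -> I A <= I B.
Hypothesis I_up : forall A : nat -> set E, (forall n, A n `<=` A n.+1) ->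
  I (A n) @[n --> \oo] --> I (\bigcup_n A n).
Hypothesis I_open : forall K a, compact K -> I K < a ->
  exists U, [/\ open U, K `<=` U & I U < a].

Lemma up_gt (A : nat -> set E) (a : \bar R) : (forall n, A n `<=` A n.+1) ->
  a < I (\bigcup_n A n) -> exists n, a < I (A n).
Proof.
move=> AS aI; apply: contrapT => H.
have := lt_le_trans aI (_ : I (\bigcup_n A n) <= a); rewrite ltxx => H'.
suff: false by []; apply: H'.
rewrite -(cvg_lim _ (I_up AS))//; apply: lime_le.
  by apply/cvg_ex; eexists; exact: I_up.
by apply: nearW => n; rewrite leNgt; apply/negP => an; apply: H; exists n.
Qed.

(* Choquet's argument: restrict the parametrization of [A] successively to
   finite unions of balls of radius [1 / n] so that the image keeps a value
   larger than [a]. *)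
Lemma souslin_compact_gt (A : set E) (a : \bar R) : souslin R A -> a < I A ->
  exists K, [/\ compact K, K `<=` A & a <= I K].
Proof.
move=> [Y [g [[[Q cQ dQ] [M [f [f' [fK f'K cf cf' complete]]]]] cg <-]]] aA.
have /countable_injP[e einj] := cQ.
pose G : M -> E := g \o f'.
have cG : continuous G.
  by move=> x; apply: continuous_comp; [exact: cf'|exact: cg].
have GA : G @` setT = range g.
  apply/seteqP; split => [_ [x _ <-]|_ [y _ <-]]; first by exists (f' x).
  by exists (f y) => //; rewrite /G/= fK.
pose C n i : set M :=
  [set z | exists y, [/\ Q y, e y = i & (mdist (f y) z <= n.+2%:R^-1)%R]].
have cC n i : closed (C n i).
  have [[y [Qy ey]]|nQ] := pselect (exists y, Q y /\ e y = i); last first.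
    rewrite (_ : C n i = set0); first exact: closed0.
    by apply/seteqP; split => // z [y [Qy ey _]]; apply: nQ; exists y.
  rewrite (_ : C n i = (dist_set [set f y]) @^-1` [set r | (r <= n.+2%:R^-1)%R]).
    apply: preimage_closed => [z _|]; last exact: closed_le.
    by apply: dist_set_continuous; exists (f y).
  have dE z : dist_set [set f y] z = mdist (f y) z.
    by rewrite /dist_set image_set1 inf1 metric_sym.
  apply/seteqP; split => z /=; rewrite dE; last by exists y.
  by move=> [y' [Qy' ey']]; rewrite (einj y' y) ?inE// ey'.
have smallC n i x y : C n i x -> C n i y -> (mdist x y < 2 / n.+1%:R)%R.
  move=> [u [Qu eu ux]] [v [Qv ev vy]].
  have uv : u = v by apply: einj; rewrite ?inE// eu ev.
  subst v; apply: (@le_lt_trans _ _ (2 / n.+2%:R)%R).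
    apply: le_trans (metric_triangle x (f u) y) _.
    by rewrite (metric_sym x) mulrDl mul1r lerD.
  by rewrite ltr_pM2l// ltf_pV2 ?posrE// ltr_nat.
have C_cover n z : exists i, C n i z.
  have e0 : (0 < n.+2%:R^-1 :> R)%R by rewrite invr_gt0.
  have [||y [By Qy]] := dQ (f @^-1` ball z n.+2%:R^-1)°.
  - exists (f' z); rewrite /interior; apply: cf; rewrite f'K.
    exact: nbhsx_ballx.
  - exact: open_interior.
  exists (e y), y; split => //; have := interior_subset By.
  by rewrite /= ballEmdist /= metric_sym => /ltW.
pose W n k := \bigcup_(i < k) C n i.
have step n (B : set M) : a < I (G @` B) -> exists k, a < I (G @` (B `&` W n k)).
  move=> aB; apply: (@up_gt (fun k => G @` (B `&` W n k))).
    move=> k; apply: image_subset => z [Bz [i /= ik Ciz]]; split => //.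
    by exists i => //=; exact: ltnW.
  rewrite (_ : \bigcup_k _ = G @` B)//; apply/seteqP; split.
    by move=> _ [k _ [z [Bz _] <-]]; exists z.
  move=> _ [z Bz <-]; have [i Ci] := C_cover n z.
  by exists i.+1 => //; exists z => //; split => //; exists i => /=.
(* The choice is made for all pairs, with [0] as default, so that [D] can be defined by recursion
   before its invariant is proved. *)
have /choice[kappa Hk] : forall nB : nat * set M, exists k,
    a < I (G @` nB.2) -> a < I (G @` (nB.2 `&` W nB.1 k)).
  move=> [n B]; have [/(step n)[k Hk]|nB] := pselect (a < I (G @` B)).
    by exists k.
  by exists 0%N.
pose D := fix D n := if n is j.+1 then D j `&` W j (kappa (j, D j)) else setT.
have aD n : a < I (G @` D n).
  by elim: n => [|n IH] /=; [rewrite GA|exact: (Hk (n, D n))].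
have cW n k : closed (W n k) by apply: closed_bigcup => // i _; exact: cC.
have cD n : closed (D n).
  by elim: n => [|n IH] /=; [exact: closedT|exact: closedI].
have decD n : D n.+1 `<=` D n by move=> z [].
have coverD n : exists k, D n.+1 `<=` \bigcup_(i < k) C n i.
  by exists (kappa (n, D n)) => z [].
pose L := \bigcap_n D n.
have cL : compact L by exact: (compact_bigcap_cover complete cD smallC coverD).
have cGL : compact (G @` L).
  by apply: continuous_compact => //; exact: continuous_subspaceT.
exists (G @` L); split => //.
  by rewrite -GA; exact: image_subset.
rewrite leNgt; apply/negP => /(I_open cGL)[U [oU LU]].
apply/negP; rewrite -leNgt.
have [|x Lx|n DU] := bigcap_cover_open complete cD smallC decD coverD (U := G @^-1` U).
- by apply: open_comp => // x _; exact: cG.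
- by apply: LU; exists x.
apply: le_trans (ltW (aD n)) _; apply: I_le => _ [x Dx <-]; exact: DU.
Qed.

Lemma souslin_capacitable (A : set E) : souslin R A -> capacitable I A.
Proof.
move=> sA; apply/eqP; rewrite eq_le; apply/andP; split; last first.
  by apply/ereal_supP => _ [K [_ KA] <-]; exact: I_le.
rewrite leNgt; apply/negP; set s := ereal_sup _ => sA'.
have s0 : 0 <= s.
  apply: le_ereal_sup_tmp; exists (I set0) => //; exists set0 => //.
  by split; [exact: compact0|exact: sub0set].
have [a sa aA] : exists2 a, s < a & a < I A.
  move: (s) s0 sA' => [r||]// _; case: (I A) => [t||]//.
    rewrite lte_fin => rt; exists ((r + t) / 2)%:E; rewrite lte_fin; lra.
  by move=> _; exists (r + 1)%:E; rewrite ?ltry// lte_fin ltrDl.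
have [K [cK KA aK]] := souslin_compact_gt sA aA.
have : I K <= s by apply: ereal_sup_ubound; exists K.
by rewrite leNgt (lt_le_trans sa aK).
Qed.

End choquet_souslin.

(** * Monotonicity of the content and the theorem *)

Lemma Modp_set0 (R : realType) (X : ptopologicalType) (m : Mplus R X) (p : R) :
  0 < p -> Modp m p set0 = 0%E.
Proof.
move=> p0; apply/eqP; rewrite eq_le Modp_ge0 andbT.
apply: le_trans (@Modp_le _ _ _ _ _ (cst 0%E) _ _ _) _ => //.
by under eq_integral do rewrite poweR0r ?gt_eqF//; rewrite integral0.
Qed.

Lemma le_Cp (R : realType) (X : ptopologicalType) (m : Mplus R X) (p : R)
    (A B : set (Mplus R X)) : A `<=` B -> (Cp m p A <= Cp m p B)%E.
Proof.
move=> AB; rewrite /Cp; case: asboolP => [/AB B0|A0].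
  by rewrite asboolT.
case: asboolP => [_|B0]; first exact: leey.
apply: ge_ereal_sup => _ [->|[eta [eb c0] <-]].
  by apply: ereal_sup_ubound; left.
apply: (@le_trans _ _ (mu_ext eta B * (cq m p eta)^-1%:E)%E).
  by apply: lee_wpmul2r; [rewrite lee_fin invr_ge0 ltW|exact: le_mu_ext].
by apply: ereal_sup_ubound; right; exists eta.
Qed.

Theorem theorem5p1 (R : realType) (X : ptopologicalType) (hX : polish R X)
    (m : Mplus R X) (p : R) (hp : 1 < p) :
  [/\ choquet_capacity (Modp m p),
      forall Sigma : set (Mplus R X), souslin R Sigma ->
        capacitable (Modp m p) Sigma /\
        (Modp m p Sigma `^ p^-1)%E = Cp m p Sigma &
      forall Sigma : set (Mplus R X), compact Sigma ->
        Modp m p Sigma = Modpc m p Sigma].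
Proof.
have p0 : 0 < p by exact: lt_trans hp.
split.
- split; [exact: Modp_ge0|exact: le_Modp|exact: Modp_bigcup|].
  exact: Modp_bigcap_compact.
- move=> S sS; have capS : capacitable (Modp m p) S.
    apply: souslin_capacitable sS; [exact: Modp_ge0|exact: le_Modp|exact: Modp_bigcup|].
    by move=> K a; exact: Modp_compact_open.
  split=> //; apply/eqP; rewrite eq_le Cp_le_Modp// andbT.
  have [S0|S0] := pselect (S (Mplus0 R X)); first by rewrite /Cp asboolT// leey.
  have CpS := Cp_ge0 m p S.
  have invK : p = p^-1^-1 by rewrite invrK.
  (* With the root moved to the other side, capacitability leaves [Modp K <= Cp S ^ p] for each
     compact [K] inside [S], where the duality for [K] and monotonicity of [Cp] apply. *)
  rewrite poweR_le_root ?invr_gt0 ?Modp_ge0// -invK capS.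
  apply: ge_ereal_sup => _ [K [cK KS] <-].
  rewrite [X in (_ <= _ `^ X)%E]invK -poweR_le_root ?invr_gt0 ?Modp_ge0//.
  apply: le_trans (le_Cp m p KS).
  have [->|K0] := eqVneq K set0.
    by rewrite Modp_set0// poweR0r ?gt_eqF ?invr_gt0 ?Cp_ge0.
  rewrite Modp_compact//; apply: Modpc_le_Cp => //; first exact/set0P.
  by move=> /KS.
- by move=> S cS; exact: Modp_compact.
Qed.
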